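(* Let $\mathscr{P}$ be a model, $\Pi$ a prior on $\mathscr{P}$ and $P^*\in\mathscr{P}$, and assume that $-P_0\log(p^*/p_0)<\infty$ and $P_0(p/p^* )<\infty$ for all $P\in\mathscr{P}$. Let $\varepsilon_n$ be strictly positive numbers with $\varepsilon_n\to0$ and $\liminf_{n} n\varepsilon_n^2>0$, such that for all natural numbers $n$ and $j$ (with $j\ge1$) $$\frac{\Pi(P\in\mathscr{P}: j\varepsilon_n<d(P,P^* )<2j\varepsilon_n)}{\Pi(B(\varepsilon_n,P^*;P_0))}\le e^{n\varepsilon_n^2j^2/8},$$ and for all $n$ $$N_t(\varepsilon,\mathscr{P},d;P_0,P^* )\le e^{n\varepsilon_n^2}\qquad\text{for all }\varepsilon>\varepsilon_n.$$ Then for every sequence $M_n\to\infty$, as $n\to\infty$, $$\Pi_n\bigl(P\in\mathscr{P}: d(P,P^* )\ge M_n\varepsilon_n\,\big|\,X_1,\ldots,X_n\bigr)\to0\qquad\text{in }L_1(P_0^n).$$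
   Context: $X_1,X_2,\ldots$ are i.i.d. observations from a probability distribution $P_0$ on a measurable space $(\mathscr{X},\mathscr{A})$. The model $\mathscr{P}$ is a collection of probability distributions on $(\mathscr{X},\mathscr{A})$ dominated by a $\sigma$-finite measure $\mu$; $P_0$ need not belong to $\mathscr{P}$ but also has a density with respect to $\mu$. Lower case letters $p,p_0,p^*$ denote $\mu$-densities of $P,P_0,P^*$, and $(x,p)\mapsto p(x)$ is measurable for the product of $\mathscr{A}$ and an appropriate $\sigma$-field on $\mathscr{P}$. The prior $\Pi$ is a probability measure on $\mathscr{P}$ (with this $\sigma$-field). The posterior mass of a measurable set $B\subset\mathscr{P}$ is $$\Pi_n(B|X_1,\ldots,X_n)=\int_B\prod_{i=1}^n p(X_i)\,d\Pi(P)\Big/\int_{\mathscr{P}}\prod_{i=1}^n p(X_i)\,d\Pi(P)\qquad(0/0:=0).$$ $d$ is a semi-metric on $\mathscr{P}$. Write $Qf=\int f\,dQ$. Convention $\log 0=-\infty$; thus $-P_0\log(p^*/p_0)<\infty$ implies $P_0\ll P^*$, and $p^*$ is taken strictly positive at the observations. Convergence in $L_1(P_0^n)$ of posterior masses means that their expectations under $X_1,\dots,X_n$ i.i.d. $P_0$ converge. Kullback–Leibler neighbourhood: $B(\varepsilon,P^*;P_0)=\{P\in\mathscr{P}: -P_0\log\frac{p}{p^*}\le\varepsilon^2,\ P_0(\log\frac{p}{p^*})^2\le\varepsilon^2\}$. Covering number for testing under misspecification: for $\varepsilon>0$, $N_t(\varepsilon,\mathscr{P},d;P_0,P^* )$ is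 the minimal number $N$ of convex sets $B_1,\ldots,B_N$ of probability measures on $(\mathscr{X},\mathscr{A})$ (with $\mu$-densities $p$; the sets need not be contained in $\mathscr{P}$) needed to cover $\{P\in\mathscr{P}:\varepsilon<d(P,P^* )<2\varepsilon\}$ such that, for every $i$, $$\inf_{P\in B_i}\ \sup_{0<\alpha<1}-\log P_0\Bigl(\frac{p}{p^*}\Bigr)^\alpha\ge\frac{\varepsilon^2}{4};$$ it is $\infty$ if there is no finite covering of this type. *)

(* Defs.v *)
From HB Require Import structures.
From mathcomp Require Import all_boot all_order all_algebra.
From mathcomp Require Import all_classical all_reals all_analysis.

Set Implicit Arguments.
Unset Strict Implicit.
Unset Printing Implicit Defensive.

Import Order.TTheory GRing.Theory Num.Theory.
Import numFieldNormedType.Exports.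

Local Open Scope classical_set_scope.
Local Open Scope ring_scope.

(* Quotients of densities are taken in R, so that a / 0 = 0.  They occur only
   under P0-integrals, with denominator p0 or p*.  Both are P0-a.s. positive:
   p0 because it is the density of P0, and p* because
   - P0 log (p* / p0) < +oo forces P0 << P*. *)

Section densities.
Context {R : realType} {dX : measure_display} {X : measurableType dX}.
Implicit Types (Q : probability X R) (q : X -> R).

Definition is_density (mu : {measure set X -> \bar R}) Q q : Prop :=
  [/\ measurable_fun setT q, forall x, 0 <= q x &
      forall A, measurable A -> Q A = (\int[mu]_(x in A) (q x)%:E)%E].

(* - P0 log (q / q'), where lne 0 = -oo. *)
Definition neg_log_ratio (P0 : probability X R) q q' : \bar R :=
  (- \int[P0]_x lne (q x / q' x)%:E)%E.

(* P0 (log (q / q'))^2 *)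
Definition sq_log_ratio (P0 : probability X R) q q' : \bar R :=
  (\int[P0]_x (lne (q x / q' x)%:E ^+ 2))%E.

(* Measures agree when they agree on measurable sets; the values that the
   underlying functions take on other sets carry no information.  Hence a
   mixture of Q1 and Q2 is any probability with the right values on
   measurable sets. *)
Definition convex_measures (B : set (probability X R)) : Prop :=
  forall Q1 Q2 Q (t : R), B Q1 -> B Q2 -> 0 <= t <= 1 ->
    (forall A, measurable A ->
       Q A = t%:E * Q1 A + (1 - t)%:E * Q2 A)%E ->
    B Q.

(* sup_(0 < a < 1) - log P0 (q / ps)^a, valued in \bar R *)
Definition testing_index (P0 : probability X R) (ps q : X -> R) : \bar R :=
  ereal_sup [set (- lne (\int[P0]_x ((q x / ps x) `^ a)%:E))%E |
             a in [set a : R | 0 < a < 1]].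

Definition has_testing_index_ge (mu : {measure set X -> \bar R})
    (P0 : probability X R) (ps : X -> R) (B : set (probability X R))
    (c : \bar R) : Prop :=
  (c <= ereal_inf [set testing_index P0 ps q |
                   q in [set q | exists2 Q, B Q & is_density mu Q q]])%E.

End densities.

(* The model is a measurable type M with a map P : M -> probability X R:
   M carries the sigma-field of the model, and the distribution labelled by
   t : M is P t, with density p t. *)
Section model.
Context {R : realType} {dX : measure_display} {X : measurableType dX}.
Context {dM : measure_display} {M : measurableType dM}.

Definition semimetric (d : M -> M -> R) : Prop :=
  [/\ forall s t, 0 <= d s t, forall t, d t t = 0,
      forall s t, d s t = d t s &
      forall r s t, d r t <= d r s + d s t].

Definition KL_ball (P0 : probability X R) (p : M -> X -> R) (ts : M)
    (eps : R) : set M :=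
  [set t | (neg_log_ratio P0 (p t) (p ts) <= (eps ^+ 2)%:E)%E /\
           (sq_log_ratio P0 (p t) (p ts) <= (eps ^+ 2)%:E)%E].

Definition shell (d : M -> M -> R) (ts : M) (a b : R) : set M :=
  [set t | a < d t ts < b].

Definition testing_cover (mu : {measure set X -> \bar R})
    (P0 : probability X R) (P : M -> probability X R) (p : M -> X -> R)
    (d : M -> M -> R) (ts : M) (eps : R)
    (N : nat) (B : 'I_N -> set (probability X R)) : Prop :=
  [/\ forall i, convex_measures (B i),
      forall i Q, B i Q -> exists q, is_density mu Q q,
      forall t, shell d ts eps (2 * eps) t -> exists i, B i (P t) &
      forall i, has_testing_index_ge mu P0 (p ts) (B i) (eps ^+ 2 / 4)%:E].

(* N_t(eps, M, d; P0, P ts); the infimum is +oo when there is no finite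
   cover. *)
Definition covering_number_testing (mu : {measure set X -> \bar R})
    (P0 : probability X R) (P : M -> probability X R) (p : M -> X -> R)
    (d : M -> M -> R) (ts : M) (eps : R) : \bar R :=
  ereal_inf [set (N%:R)%:E | N in
    [set N : nat | exists B : 'I_N -> set (probability X R),
                     testing_cover mu P0 P p d ts eps B]].

Definition likelihood (p : M -> X -> R) (n : nat) (x : nat -> X) (t : M) : R :=
  \prod_(i < n) p t (x i).

(* The observations X_1, ..., X_n are x 0, ..., x n.-1.  In \bar R,
   0 / 0 = 0 * +oo = 0. *)
Definition posterior (Pi : probability M R) (p : M -> X -> R)
    (n : nat) (x : nat -> X) (B : set M) : \bar R :=
  ((\int[Pi]_(t in B) (likelihood p n x t)%:E) /
   (\int[Pi]_t (likelihood p n x t)%:E))%E.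

End model.

Section iid.
Context {R : realType} {dX : measure_display} {X : measurableType dX}.
Context {dO : measure_display} {Omega : measurableType dO}.

Definition independent_seq (Pr : probability Omega R)
    (Y : nat -> Omega -> X) : Prop :=
  forall (s : seq nat) (A : nat -> set X),
    uniq s -> (forall i, measurable (A i)) ->
    Pr (\bigcap_(i in [set` s]) (Y i @^-1` A i)) =
      (\prod_(i <- s) Pr (Y i @^-1` A i))%E.

Definition iid (Pr : probability Omega R) (P0 : probability X R)
    (Y : nat -> Omega -> X) : Prop :=
  [/\ forall i, measurable_fun setT (Y i),
      forall i A, measurable A -> Pr (Y i @^-1` A) = P0 A &
      independent_seq Pr Y].

End iid.

(* Main.v *)
(* Dividing every density by p^* turns the posterior into a ratio of integrals
   of likelihood ratios prod_i (p / p^* )(X_i).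

   Denominator: for each P in the Kullback-Leibler ball, Chebyshev's inequality
   for sum_i log (p / p^* )(X_i) shows that the likelihood ratio is rarely below
   exp (- n eps_n^2 (1 + C)); averaging over the prior (Fubini) bounds the
   expected deficit of the denominator.

   Numerator: cut {d (P, P^* ) > J eps_n} into shells (j eps_n, 2 j eps_n), J <= j.
   It suffices to bound E min (1, L / c), where L is the integral of the
   likelihood ratio over a shell, so no test functions are needed.  By Maurey's
   empirical method L is close in L1 to a finite average of likelihood ratios at
   points of the shell, and the points are distributed over the N convex sets of
   the cover.  For finitely many points of one convex set, min (1, y) <= y^a
   reduces the problem to E (sum_k v_k prod_i r_k (X_i))^a.  Conditioning on all
   observations but the last, the inner sum is a multiple of an element of the
   convex set, so each observation contributes a factor at most rho.  This needs
   one exponent a valid for the whole convex hull, whereas the testing condition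
   gives an exponent depending on the element; a minimax argument, convex in the
   exponent and concave in the element, makes it uniform. *)

Require Import Defs.
From HB Require Import structures.
From mathcomp Require Import all_boot all_order all_algebra.
From mathcomp Require Import all_classical all_reals all_analysis.
From mathcomp Require Import measurable_realfun measurable_fun_approximation.
From mathcomp Require Import ring lra zify unstable.

Set Implicit Arguments.
Unset Strict Implicit.
Unset Printing Implicit Defensive.

Import Order.TTheory GRing.Theory Num.Theory.
Import numFieldNormedType.Exports.

Local Open Scope classical_set_scope.
Local Open Scope ring_scope.

(** * A one-dimensional minimax theorem *)

Definition convex_on_01 (R : realType) (g : R -> R) : Prop :=
  forall a b t : R, 0 < a < 1 -> 0 < b < 1 -> 0 <= t <= 1 ->
    g (t * a + (1 - t) * b) <= t * g a + (1 - t) * g b.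

Lemma convex01_in (R : realType) (a b t : R) :
  0 < a < 1 -> 0 < b < 1 -> 0 <= t <= 1 -> 0 < t * a + (1 - t) * b < 1.
Proof.
move=> /andP[a0 a1] /andP[b0 b1] /andP[t0 t1].
have [t_0|t_gt0] := eqVneq t 0; first by rewrite t_0; lra.
have {}t_gt0 : 0 < t by rewrite lt_neqAle eq_sym t_gt0.
have ta : 0 < t * a by exact: mulr_gt0.
have ta1 : 0 < t * (1 - a) by apply: mulr_gt0 => //; lra.
have tb : 0 <= (1 - t) * b by apply: mulr_ge0; lra.
have tb1 : 0 <= (1 - t) * (1 - b) by apply: mulr_ge0; lra.
by lra.
Qed.

Lemma convex_alternative (R : realType) (g1 g2 : R -> R) (c : R) :
  convex_on_01 g1 -> convex_on_01 g2 ->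
  (forall a, 0 < a < 1 -> c <= g1 a \/ c <= g2 a) ->
  exists2 t : R, 0 <= t <= 1 &
    forall a, 0 < a < 1 -> c <= t * g1 a + (1 - t) * g2 a.
Proof.
move=> cvx1 cvx2 gc.
pose gam b := (c - g2 b) / (g1 b - g2 b).
pose bet a := (g2 a - c) / (g2 a - g1 a).
pose E := [set t | t = 0 \/ exists2 b, 0 < b < 1 /\ g2 b < c & t = gam b].
have gam1 b : 0 < b < 1 -> g2 b < c -> gam b <= 1.
  move=> b01 g2b; have g1b : c <= g1 b by case: (gc b b01) => //; lra.
  by rewrite /gam ler_pdivrMr; lra.
have E0 : E !=set0 by exists 0; left.
have Eub : ubound E 1 by move=> _ [->|[b [b01 g2b] ->]] //; exact: gam1.
have Esup : has_sup E by split => //; exists 1.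
have cross a b : 0 < a < 1 -> 0 < b < 1 -> g1 a < c -> g2 b < c ->
    gam b <= bet a.
  move=> a01 b01 g1a g2b.
  have g2a : c <= g2 a by case: (gc a a01) => //; lra.
  have g1b : c <= g1 b by case: (gc b b01) => //; lra.
  rewrite leNgt; apply/negP => /[!ltr_pdivrMr]; last by lra.
  rewrite mulrAC ltr_pdivlMr; last by lra.
  move=> lt_vp.
  pose D := (c - g1 a) + (g2 a - c) + (c - g2 b) + (g1 b - c).
  have D0 : 0 < D by rewrite /D; lra.
  pose s := ((c - g2 b) + (g1 b - c)) / D.
  have sD : s * D = (c - g2 b) + (g1 b - c).
    by rewrite /s divfK// gt_eqF.
  have s01 : 0 <= s <= 1.
    rewrite /s; apply/andP; split; first by apply: divr_ge0; lra.
    by rewrite ler_pdivrMr// /D; lra.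
  have x01 := convex01_in a01 b01 s01.
  have := gc _ x01; have := cvx1 a b s a01 b01 s01.
  have := cvx2 a b s a01 b01 s01 => le2 le1.
  suff [h1 h2] : s * g1 a + (1 - s) * g1 b < c /\
                 s * g2 a + (1 - s) * g2 b < c by case; lra.
  by split; rewrite -(ltr_pM2r D0) /D in sD *; nra.
exists (sup E).
  apply/andP; split; first by apply: ub_le_sup; [exists 1|left].
  exact: ge_sup.
move=> a a01.
have [g1a|g1a] := ltP (g1 a) c.
  have g2a : c <= g2 a by case: (gc a a01) => //; lra.
  have : sup E <= bet a.
    apply: ge_sup => // _ [->|[b [b01 g2b] ->]]; last exact: cross.
    by apply: divr_ge0; lra.
  by rewrite ler_pdivlMr; [nra|lra].
have [g2a|g2a] := ltP (g2 a) c; last first.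
  have : 0 <= sup E by apply: ub_le_sup; [exists 1|left].
  have : sup E <= 1 by apply: ge_sup.
  by nra.
have : gam a <= sup E by apply: ub_le_sup; [exists 1|right; exists a].
by rewrite ler_pdivrMr; [nra|lra].
Qed.

Lemma convex_concave_minimax (R : realType) (T : Type) (C : set T)
    (g : T -> R -> R) (c : R) :
  (forall r, C r -> convex_on_01 (g r)) ->
  (forall r1 r2 t, C r1 -> C r2 -> 0 <= t <= 1 ->
     exists2 r, C r & forall a, 0 < a < 1 ->
       t * g r1 a + (1 - t) * g r2 a <= g r a) ->
  (forall r, C r -> exists2 a, 0 < a < 1 & g r a < c) ->
  exists2 a, 0 <= a <= 1 & forall r e, C r -> 0 < e ->
    exists2 b, 0 < b < 1 /\ `|b - a| < e & g r b < c.
Proof.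
move=> cvx ccv lt_c.
have [[r0 Cr0]|C0] := pselect (C !=set0); last first.
  by exists 0 => [|r e Cr]; [rewrite lexx ler01|case: C0; exists r].
have common r1 r2 : C r1 -> C r2 ->
    exists2 a, 0 < a < 1 & g r1 a < c /\ g r2 a < c.
  move=> C1 C2; apply: contrapT => nex.
  have [|t t01 tc] := @convex_alternative _ _ _ c (cvx _ C1) (cvx _ C2).
    move=> a a01; have [g1|] := ltP (g r1 a) c; last by left.
    have [g2|] := ltP (g r2 a) c; last by right.
    by case: nex; exists a.
  have [r Cr rle] := ccv _ _ _ C1 C2 t01; have [a a01 ga] := lt_c _ Cr.
  by have := rle a a01; have := tc a a01; lra.
pose E := [set x : R | exists2 r, C r &
  forall s, 0 < s < 1 -> g r s < c -> x <= s].
have E0 : E 0 by exists r0 => // s /andP[/ltW].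
have Eub : ubound E 1.
  move=> x [r Cr xle]; have [a a01 ga] := lt_c _ Cr.
  by have := xle _ a01 ga; lra.
have Esup : has_sup E by split; [exists 0|exists 1].
(* [sup E] is the supremum over [r] of the left ends of [{a | g r a < c}]; as
   these intervals meet pairwise, it is in the closure of each of them. *)
exists (sup E).
  apply/andP; split; first by apply: ub_le_sup => //; exists 1.
  by apply: ge_sup => //; exists 0.
move=> r e Cr e0; set s := sup E.
have [b1 [b101 gb1 b1s]] : exists b, [/\ 0 < b < 1, g r b < c & b < s + e].
  apply: contrapT => nex; suff : s + e <= s by lra.
  apply: ub_le_sup; first by exists 1.
  exists r => // b b01 gb; rewrite leNgt; apply/negP => bs.
  by apply: nex; exists b.
have [b2 [b201 gb2 b2s]] : exists b, [/\ 0 < b < 1, g r b < c & s - e < b].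
  have [x [r' Cr' xle] sx] := sup_adherent e0 Esup.
  have [a a01 [ga ga']] := common _ _ Cr Cr'.
  by exists a; split => //; apply: lt_le_trans sx _; exact: xle.
have [h1|h1] := ltP (s - e) b1.
  by exists b1 => //; split => //; rewrite ltr_norml; lra.
have [h2|h2] := ltP b2 (s + e).
  by exists b2 => //; split => //; rewrite ltr_norml; lra.
pose t := (b2 - s) / (b2 - b1).
have b12 : 0 < b2 - b1 by lra.
have tb : t * (b2 - b1) = b2 - s by rewrite /t divfK// gt_eqF.
have t01 : 0 <= t <= 1.
  rewrite /t; apply/andP; split; first by apply: divr_ge0; lra.
  by rewrite ler_pdivrMr//; lra.
have sE : s = t * b1 + (1 - t) * b2 by lra.
exists s; last by rewrite sE; have := cvx _ Cr _ _ _ b101 b201 t01; nra.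
by split; [rewrite sE; exact: convex01_in|rewrite subrr normr0].
Qed.

(** * Power means *)

Section le_ge0_integral.
Import HBNNSimple.

Lemma le_ge0_integral d (T : measurableType d) (R : realType)
    (mu : {measure set T -> \bar R}) (D : set T) (f g : T -> \bar R) :
  (forall x, D x -> 0 <= f x)%E -> (forall x, D x -> f x <= g x)%E ->
  (\int[mu]_(x in D) f x <= \int[mu]_(x in D) g x)%E.
Proof.
move=> f0 fg; rewrite integral_mkcond [leRHS]integral_mkcond.
have g0 x : D x -> (0 <= g x)%E.
  by move=> Dx; apply: le_trans (fg _ Dx); exact: f0.
rewrite !ge0_integralTE; last 2 first.
- exact: erestrict_ge0.
- exact: erestrict_ge0.
apply: ereal_sup_le => _ [h hf <-].
exists h => // x; apply: le_trans (hf x) _; exact: lee_restrict.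
Qed.

End le_ge0_integral.

Lemma ge0_integral_lin2 d (T : measurableType d) (R : realType)
    (mu : {measure set T -> \bar R}) (f g : T -> R) (s t : R) :
  measurable_fun setT f -> measurable_fun setT g ->
  (forall x, 0 <= f x) -> (forall x, 0 <= g x) -> 0 <= s -> 0 <= t ->
  (\int[mu]_x (s * f x + t * g x)%:E =
   s%:E * \int[mu]_x (f x)%:E + t%:E * \int[mu]_x (g x)%:E)%E.
Proof.
move=> mf mg f0 g0 s0 t0.
under eq_integral do rewrite EFinD !EFinM.
rewrite ge0_integralD//; last 4 first.
- by move=> x _; rewrite -EFinM lee_fin mulr_ge0.
- by apply/measurable_EFinP; exact: measurable_funM.
- by move=> x _; rewrite -EFinM lee_fin mulr_ge0.
- by apply/measurable_EFinP; exact: measurable_funM.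
by rewrite !ge0_integralZl_EFin//; do ?[by move=> x _; rewrite lee_fin|
  exact/measurable_EFinP].
Qed.

Lemma powR_convex_exponent (R : realType) (x a b t : R) :
  0 <= x -> 0 < a < 1 -> 0 < b < 1 -> 0 <= t <= 1 ->
  x `^ (t * a + (1 - t) * b) <= t * x `^ a + (1 - t) * x `^ b.
Proof.
move=> x0 a01 b01 t01; have c01 := convex01_in a01 b01 t01.
have [->|xneq0] := eqVneq x 0.
  rewrite !powR0 ?gt_eqF ?mulr0 ?addr0//; first by case/andP: b01.
  - by case/andP: a01.
  - by case/andP: c01.
rewrite /powR (negbTE xneq0).
have [t0 t1] := andP t01.
have := convex_expR (Itv01 t0 t1) (a * ln x) (b * ln x).
rewrite !convRE /= /onem.
suff -> : (t * a + (1 - t) * b) * ln x =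
  t * (a * ln x) + (1 - t) * (b * ln x) by [].
by ring.
Qed.

Lemma powR_concave (R : realType) (x y a t : R) :
  0 <= x -> 0 <= y -> 0 < a <= 1 -> 0 <= t <= 1 ->
  t * x `^ a + (1 - t) * y `^ a <= (t * x + (1 - t) * y) `^ a.
Proof.
move=> x0 y0 /andP[a0 a1] /andP[t0 t1].
have ai : 1 <= a^-1 by rewrite invf_ge1.
have := @convex_powR R _ ai (Itv01 t0 t1) (x `^ a) (y `^ a).
rewrite !inE /= !in_itv/= !andbT !powR_ge0 => /(_ isT isT).
rewrite !convRE /= /onem -!powRrM divff ?gt_eqF// !powRr1// => le1.
have {}le1 := ge0_ler_powR (ltW a0) _ _ le1.
have w0 : 0 <= t * x `^ a + (1 - t) * y `^ a.
  by rewrite addr_ge0// mulr_ge0 ?powR_ge0// subr_ge0.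
rewrite -powRrM mulVf ?gt_eqF// powRr1// in le1.
apply: le1; rewrite nnegrE ?powR_ge0//.
by rewrite addr_ge0// mulr_ge0// subr_ge0.
Qed.

Lemma powR_le1D (R : realType) (x a : R) :
  0 <= x -> 0 <= a <= 1 -> x `^ a <= 1 + x.
Proof.
move=> x0 /andP[a0 a1]; have [x1|x1] := leP 1 x.
  by apply: (le_trans (ler1_powR x1 a1)); rewrite lerDr.
have [->|xneq0] := eqVneq x 0.
  by rewrite /powR eqxx addr0; case: eqP.
have xi : 0 < x <= 1 by rewrite lt_neqAle eq_sym xneq0 x0 ltW.
by apply: (le_trans (ger_powR xi a0)); rewrite powRr0 lerDl.
Qed.

Lemma fine_le_lin2 (R : realType) (x y z : \bar R) (s t : R) :
  x \is a fin_num -> y \is a fin_num -> z \is a fin_num ->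
  (z <= s%:E * x + t%:E * y)%E -> fine z <= s * fine x + t * fine y.
Proof. by move: x y z => [x||] [y||] [z||]. Qed.

Lemma fine_ge_lin2 (R : realType) (x y z : \bar R) (s t : R) :
  x \is a fin_num -> y \is a fin_num -> z \is a fin_num ->
  (s%:E * x + t%:E * y <= z)%E -> s * fine x + t * fine y <= fine z.
Proof. by move: x y z => [x||] [y||] [z||]. Qed.

Section power_mean.
Context {R : realType} {d : measure_display} {X : measurableType d}.
Variable Q : probability X R.

Definition power_mean (r : X -> R) (a : R) : \bar R :=
  (\int[Q]_x ((r x) `^ a)%:E)%E.

Definition ge0_integrable (r : X -> R) : Prop :=
  [/\ measurable_fun setT r, forall x, 0 <= r x &
      (\int[Q]_x (r x)%:E < +oo)%E].

Lemma measurable_powR_comp (r : X -> R) (a : R) :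
  measurable_fun setT r -> measurable_fun setT (fun x => r x `^ a).
Proof. by move=> mr; exact: (@measurableT_comp _ _ _ _ _ _ (@powR R ^~ a)). Qed.

Lemma power_mean_ge0 r a : (0 <= power_mean r a)%E.
Proof. by apply: integral_ge0 => x _; rewrite lee_fin powR_ge0. Qed.

Lemma power_mean_fin_num r a : ge0_integrable r -> 0 <= a <= 1 ->
  power_mean r a \is a fin_num.
Proof.
move=> [mr r0 ioo] a01; rewrite ge0_fin_numE ?power_mean_ge0//.
apply: (@le_lt_trans _ _ (\int[Q]_x (1 * 1 + 1 * r x)%:E)%E).
  apply: le_ge0_integral => x _; rewrite lee_fin ?powR_ge0// !mul1r.
  exact: powR_le1D.
have I1 : (\int[Q]_x (cst 1 x : R)%:E = 1)%E.
  have := integral_cst Q measurableT 1%E.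
  by rewrite [X in _ = (_ * X)%E]probability_setT mule1.
by rewrite (ge0_integral_lin2 Q (f := cst 1))// I1 !mul1e lte_add_pinfty// ltry.
Qed.

Lemma power_mean_convex r : ge0_integrable r ->
  convex_on_01 (fun a => fine (power_mean r a)).
Proof.
move=> ir a b t a01 b01 t01; have [mr r0 _] := ir.
have c01 := convex01_in a01 b01 t01.
have l01 (s : R) : 0 < s < 1 -> 0 <= s <= 1 by case/andP=> /ltW-> /ltW->.
have fa := power_mean_fin_num ir (l01 _ a01).
have fb := power_mean_fin_num ir (l01 _ b01).
have fc := power_mean_fin_num ir (l01 _ c01).
have [t0 t1] := andP t01.
apply: fine_le_lin2 => //.
rewrite -ge0_integral_lin2 ?subr_ge0//; last 4 first.
- exact: measurable_powR_comp.
- exact: measurable_powR_comp.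
- by move=> x; exact: powR_ge0.
- by move=> x; exact: powR_ge0.
apply: le_ge0_integral => x _; rewrite lee_fin ?powR_ge0//.
exact: powR_convex_exponent.
Qed.

Lemma power_mean_concave r1 r2 a t : ge0_integrable r1 -> ge0_integrable r2 ->
  0 < a <= 1 -> 0 <= t <= 1 ->
  (t%:E * power_mean r1 a + (1 - t)%:E * power_mean r2 a <=
   power_mean (fun x => t * r1 x + (1 - t) * r2 x)%R a)%E.
Proof.
move=> [m1 r10 i1] [m2 r20 i2] a01 t01; have [t0 t1] := andP t01.
rewrite -ge0_integral_lin2 ?subr_ge0//; last 4 first.
- exact: measurable_powR_comp.
- exact: measurable_powR_comp.
- by move=> x; exact: powR_ge0.
- by move=> x; exact: powR_ge0.
apply: le_ge0_integral => x _; rewrite lee_fin.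
  by rewrite addr_ge0// mulr_ge0 ?powR_ge0// subr_ge0.
exact: powR_concave.
Qed.

Lemma cvg_powR_exponent (x : R) (a : R) (b : nat -> R) : 0 <= x -> 0 < a ->
  (forall n, 0 < b n) -> b n @[n --> \oo] --> a ->
  (x `^ b n)%:E @[n --> \oo] --> (x `^ a)%:E.
Proof.
move=> x0 a0 b0 ba; apply: cvg_EFin; first by near=> n.
have [->|xneq0] := eqVneq x 0.
  rewrite powR0 ?gt_eqF//; apply: cvg_near_cst; near=> n.
  by rewrite /= powR0// gt_eqF.
rewrite /powR /= (negbTE xneq0).
apply: continuous_cvg; first exact: continuous_expR.
exact: cvgMl.
Unshelve. all: by end_near. Qed.

Lemma power_mean_le_lim (r : X -> R) (a : R) (c : \bar R) (b : nat -> R) :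
  ge0_integrable r -> 0 < a ->
  (forall n, 0 < b n) -> b n @[n --> \oo] --> a ->
  (forall n, power_mean r (b n) <= c)%E -> (power_mean r a <= c)%E.
Proof.
move=> [mr r0 _] a0 b0 ba le_c.
have -> : power_mean r a =
    (\int[Q]_x limn_einf (fun n => (r x `^ b n)%:E))%E.
  apply: eq_integral => x _; apply/esym.
  by have [] := cvg_limn_einf_sup (cvg_powR_exponent (r0 x) a0 b0 ba).
apply: (le_trans (fatou _ _ _ _)) => //.
- by move=> n; apply/measurable_EFinP; exact: measurable_powR_comp.
- by move=> n x _; rewrite lee_fin powR_ge0.
rewrite limn_einf_lim.
apply: lime_le; first exact: is_cvg_einfs.
near=> n; apply: le_trans (le_c n); apply: ereal_inf_lbound.
by exists n => /=.
Unshelve. all: by end_near. Qed.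

(* The saddle exponent may degenerate to 0; there the uniform domination by [u]
   transfers the bound for [u] to the whole class. *)
Lemma uniform_exponent (C : set (X -> R)) (u : X -> R) (m c c' : R) :
  0 < c < c' -> 1 <= m -> C u ->
  (forall r, C r -> ge0_integrable r) ->
  (forall r, C r -> forall x, r x <= m * u x) ->
  (forall r1 r2 t, C r1 -> C r2 -> 0 <= t <= 1 ->
     C (fun x => t * r1 x + (1 - t) * r2 x)) ->
  (forall r, C r -> exists2 a, 0 < a < 1 & (power_mean r a < c%:E)%E) ->
  exists2 a, 0 < a <= 1 & forall r, C r -> (power_mean r a <= c'%:E)%E.
Proof.
move=> /andP[c0 cc'] m1 Cu Cint Cdom Ccvx Clt.
have l01 (s : R) : 0 < s < 1 -> 0 <= s <= 1 by case/andP=> /ltW-> /ltW->.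
have fin r a : C r -> 0 < a < 1 -> power_mean r a \is a fin_num.
  by move=> Cr a01; apply: power_mean_fin_num; [exact: Cint|exact: l01].
have [|r1 r2 t C1 C2 t01|r Cr|a /andP[a0 a1] acl] :=
    @convex_concave_minimax R _ C (fun r a => fine (power_mean r a)) c.
- by move=> r Cr; apply: power_mean_convex; exact: Cint.
- exists (fun x => t * r1 x + (1 - t) * r2 x); first exact: Ccvx.
  move=> a a01; apply: fine_ge_lin2; [exact: fin|exact: fin| |].
    by apply: fin => //; exact: Ccvx.
  apply: power_mean_concave => //; [exact: Cint|exact: Cint|].
  by case/andP: a01 => -> /ltW ->.
- have [a a01 ac] := Clt _ Cr; exists a => //.
  by rewrite -lte_fin fineK//; exact: fin.
have {}acl r e : C r -> 0 < e ->
    exists b, [/\ 0 < b < 1, `|b - a| < e & (power_mean r b <= c%:E)%E].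
  move=> Cr e0; have [b [b01 ba] gb] := acl _ _ Cr e0; exists b; split => //.
  by rewrite -(fineK (fin _ _ Cr b01)) lee_fin ltW.
have [a_eq0|a_neq0] := eqVneq a 0.
  pose e := (ln c' - ln c) / (1 + ln m).
  have lnm : 0 <= ln m by exact: ln_ge0.
  have e0 : 0 < e.
    by rewrite divr_gt0 ?subr_gt0 ?ltr_ln ?posrE//; lra.
  have [b [b01 ba gb]] := acl _ _ Cu e0.
  have [b0 b1] := andP b01.
  exists b; first by rewrite b0 ltW.
  move=> r Cr; have [mr r0 _] := Cint _ Cr; have [mu u0 _] := Cint _ Cu.
  have m0 : 0 < m by lra.
  have c'0 : 0 < c' by lra.
  have mb : m `^ b * c <= c'.
    rewrite /powR gt_eqF//.
    rewrite -[X in _ * X](@lnK _ c) ?posrE// -[leRHS](@lnK _ c') ?posrE//.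
    rewrite -expRD ler_expR; rewrite a_eq0 subr0 gtr0_norm// in ba.
    move: ba; rewrite ltr_pdivlMr; last by lra.
    by nra.
  apply: (@le_trans _ _ ((m `^ b)%:E * power_mean u b)%E); last first.
    apply: (@le_trans _ _ ((m `^ b)%:E * c%:E)%E).
      by rewrite lee_pmul2l// lte_fin powR_gt0.
    by rewrite -EFinM lee_fin.
  rewrite -ge0_integralZl_EFin ?powR_ge0//; last 2 first.
  - by move=> x _; rewrite lee_fin powR_ge0.
  - by apply/measurable_EFinP; exact: measurable_powR_comp.
  apply: le_ge0_integral => x _; first by rewrite lee_fin powR_ge0.
  rewrite -EFinM lee_fin -powRM//; last by lra.
  by apply: ge0_ler_powR; rewrite ?nnegrE ?Cdom ?mulr_ge0//; lra.
have {}a0 : 0 < a by rewrite lt_neqAle eq_sym a_neq0.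
exists a; first by rewrite a0.
move=> r Cr.
have /choice[b bP] : forall n : nat, exists b : R,
    [/\ 0 < b < 1, `|b - a| < n.+1%:R^-1 & (power_mean r b <= c%:E)%E].
  by move=> n; apply: acl => //; rewrite invr_gt0.
apply: (@le_trans _ _ c%:E); last by rewrite lee_fin ltW.
apply: (@power_mean_le_lim _ a _ b); [exact: Cint|by []| | |].
- by move=> n; have [/andP[]] := bP n.
- apply/cvgrPdist_lt => e e0; near=> n.
  have [_ + _] := bP n; rewrite distrC => /lt_trans; apply.
  by near: n; exact: near_infty_natSinv_lt (PosNum e0).
- by move=> n; have [_ _] := bP n.
Unshelve. all: by end_near. Qed.

End power_mean.

(** * Independent observations *)

Section iid_tonelli.
Context {R : realType} {dX : measure_display} {X : measurableType dX}.
Context {dO : measure_display} {Omega : measurableType dO}.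
Variables (Pr : probability Omega R) (P0 : probability X R).
Variable Y : nat -> Omega -> X.
Hypothesis Y_iid : iid Pr P0 Y.

(* The sigma-field of the first [n] observations is put on a copy of [Omega]
   itself, so that functions of the past need no product space. *)
Definition past_box (n : nat) : set (set Omega) :=
  [set \bigcap_(i in [set` iota 0 n]) (Y i @^-1` A i) |
     A in [set A : nat -> set X | forall i, measurable (A i)]].

Definition past (n : nat) := g_sigma_algebraType (past_box n).

Lemma measurable_obs i : measurable_fun setT (Y i).
Proof. by have [] := Y_iid. Qed.

Lemma measurable_obs_preimage i A : measurable A -> measurable (Y i @^-1` A).
Proof. by move=> mA; rewrite -[X in measurable X]setTI; exact: measurable_obs. Qed.

Lemma past_box_measurable n : past_box n `<=` measurable.
Proof.
move=> _ [A mA <-]; rewrite bigcap_seq; apply: bigsetI_measurable => i _.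
exact: measurable_obs_preimage.
Qed.

Lemma past_boxT n : past_box n setT.
Proof.
exists (fun=> setT); first by move=> i /=; exact: measurableT.
by rewrite -subTset => w _ i _.
Qed.

Lemma past_boxI n : setI_closed (past_box n).
Proof.
move=> _ _ [A mA <-] [B mB <-]; exists (fun i => A i `&` B i).
  by move=> i; exact: measurableI.
by rewrite -bigcapI.
Qed.

Lemma past_box_indep n A B : past_box n A -> measurable B ->
  (Pr (A `&` (Y n @^-1` B)) = Pr A * P0 B)%E.
Proof.
move=> [C mC <-] mB; have [_ Y_law Y_ind] := Y_iid.
pose D i := if i == n then B else C i.
have mD i : measurable (D i) by rewrite /D; case: ifP.
have DC : {in iota 0 n, D =1 C}.
  by move=> i; rewrite mem_iota add0n /D => /= /ltn_eqF ->.
have -> : \bigcap_(i in [set` iota 0 n]) (Y i @^-1` C i) `&` Y n @^-1` B =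
    \bigcap_(i in [set` n :: iota 0 n]) (Y i @^-1` D i).
  rewrite !bigcap_seq big_cons {1}/D eqxx setIC; congr (_ `&` _).
  by apply: eq_big_seq => i /DC ->.
rewrite Y_ind//; last by rewrite /= mem_iota add0n ltnn iota_uniq.
rewrite big_cons {1}/D eqxx Y_law// muleC Y_ind ?iota_uniq//.
by congr (_ * _)%E; apply: eq_big_seq => i /DC ->.
Qed.

Lemma past_indep n A B : <<s past_box n >> A -> measurable B ->
  (Pr (A `&` (Y n @^-1` B)) = Pr A * P0 B)%E.
Proof.
move=> pA mB; have mYB := measurable_obs_preimage n mB.
have P0B : (0 <= fine (P0 B))%R by exact: fine_ge0.
rewrite muleC -[P0 B]fineK ?fin_num_measure//.
have := @g_sigma_algebra_measure_unique _ R Omega (past_box n)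
  (@past_box_measurable n) (fun=> setT) (fun=> past_boxT n) _
  (mrestr Pr mYB) (mscale (NngNum P0B) Pr) (@past_boxI n) _ _ A pA.
apply => //.
- by rewrite bigcup_const.
- move=> C pC; rewrite [LHS](past_box_indep pC mB) muleC; congr (_ * _)%E.
  by apply/esym/fineK; exact: fin_num_measure.
- move=> k; apply: (@le_lt_trans _ _ (Pr (setT `&` Y n @^-1` B))) => //.
  by rewrite setTI (le_lt_trans (probability_le1 _ _))// ltry.
Qed.

Lemma measurable_past_id n :
  measurable_fun setT (fun w : Omega => w : past n).
Proof.
move=> _ A pA; rewrite setTI; move: pA; apply: smallest_sub.
  exact: sigma_algebra_measurable.
exact: past_box_measurable.
Qed.

Lemma measurable_past_obs n i : (i < n)%N ->
  measurable_fun setT (fun w : past n => Y i w).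
Proof.
move=> ltin _ A mA; rewrite setTI; apply: sub_sigma_algebra.
exists (fun j => if j == i then A else setT) => [j|].
  by case: ifP.
apply/seteqP; split=> [w /(_ i) /=|w Aw j _ /=].
  by rewrite eqxx; apply; rewrite mem_iota.
by case: ifP => // /eqP ->.
Qed.

Lemma iid_tonelli n (F : past n * X -> \bar R) :
  measurable_fun setT F -> (forall z, 0 <= F z)%E ->
  (\int[Pr]_w F (w, Y n w) = \int[Pr]_w \int[P0]_x F (w, x))%E.
Proof.
move=> mF F0.
pose idm : {mfun Omega >-> past n} :=
  HB.pack (fun w : Omega => w : past n)
    (isMeasurableFun.Build _ _ _ _ _ (@measurable_past_id n)).
have mJ : measurable_fun setT (fun w : Omega => ((w : past n), Y n w)).
  by apply: measurable_fun_pair; [exact: measurable_past_id|exact: measurable_obs].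
pose J : {mfun Omega >-> (past n * X)%type} := HB.pack
  (fun w : Omega => ((w : past n), Y n w)) (isMeasurableFun.Build _ _ _ _ _ mJ).
have prodE C : measurable C ->
    (distribution Pr idm \x P0)%E C = distribution Pr J C.
  apply: product_measure_unique => A B mA mB.
  exact: (past_indep mA mB).
transitivity (\int[distribution Pr J]_z F z)%E.
  by rewrite ge0_integral_distribution.
transitivity (\int[distribution Pr idm \x P0]_z F z)%E.
  by apply: eq_measure_integral => A mA _; exact/esym/prodE.
rewrite fubini_tonelli1// ge0_integral_distribution//.
- exact: measurable_fun_fubini_tonelli_F.
- by move=> w; exact: integral_ge0.
Qed.

End iid_tonelli.

Lemma probability_integral_cst d (T : measurableType d) (R : realType)
  (Q : probability T R) (c : \bar R) : (\int[Q]_x c = c)%E.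
Proof. by rewrite integral_cst// [X in (_ * X)%E]probability_setT mule1. Qed.

Lemma ge0_markov d (T : measurableType d) (R : realType)
    (mu : {measure set T -> \bar R}) (f : T -> \bar R) (A : set T) (c : R) :
  (forall x, 0 <= f x)%E -> measurable A -> 0 <= c ->
  (forall x, A x -> c%:E <= f x)%E ->
  (c%:E * mu A <= \int[mu]_x f x)%E.
Proof.
move=> f0 mA c0 cf; rewrite -(integral_cst mu mA).
rewrite integral_mkcond; apply: le_ge0_integral => x _.
  by rewrite patchE; case: ifP.
by rewrite patchE; case: ifPn => // /[!inE]; exact: cf.
Qed.

Section iid_consequences.
Context {R : realType} {dX : measure_display} {X : measurableType dX}.
Context {dO : measure_display} {Omega : measurableType dO}.
Variables (Pr : probability Omega R) (P0 : probability X R).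
Variable Y : nat -> Omega -> X.
Hypothesis Y_iid : iid Pr P0 Y.

Let mY i : measurable_fun setT (Y i). Proof. exact: measurable_obs Y_iid i. Qed.

Lemma measurable_past_comp n i (f : X -> R) : (i < n)%N ->
  measurable_fun setT f ->
  measurable_fun setT (fun z : past Y n * X => f (Y i z.1)).
Proof.
move=> ltin mf; apply: (measurableT_comp mf).
apply: (@measurableT_comp _ _ _ _ _ _ (fun w : past Y n => Y i w) _ fst) => //.
exact: measurable_past_obs.
Qed.

Lemma integral_mixture_power (T : eqType) (s : seq T) (r : T -> X -> R)
    (a c : R) :
  (forall k, measurable_fun setT (r k)) -> (forall k x, 0 <= r k x) -> 0 <= c ->
  (forall v : T -> R, (forall k, 0 <= v k) ->
     (\int[P0]_x ((\sum_(k <- s) v k * r k x) `^ a)%:E <=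
      (c * (\sum_(k <- s) v k) `^ a)%:E)%E) ->
  forall n (u : T -> R), (forall k, 0 <= u k) ->
  (\int[Pr]_w ((\sum_(k <- s) u k * \prod_(i < n) r k (Y i w)) `^ a)%:E <=
   ((\sum_(k <- s) u k) `^ a * c ^+ n)%:E)%E.
Proof.
move=> mr r0 c0 rc; elim=> [|n IHn] u u0.
  under eq_integral do under eq_bigr do rewrite big_ord0 mulr1.
  by rewrite probability_integral_cst expr0 mulr1.
pose S (w : Omega) := \sum_(k <- s) u k * \prod_(i < n) r k (Y i w).
pose F (z : past Y n * X) :=
  ((\sum_(k <- s) (u k * \prod_(i < n) r k (Y i z.1)) * r k z.2) `^ a)%:E.
have mF : measurable_fun setT F.
  apply/measurable_EFinP; apply: measurable_powR_comp.
  apply: measurable_sum => k; apply: measurable_funM.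
    apply: measurable_funM => //; apply: measurable_prod => i _.
    exact: measurable_past_comp.
  exact: measurableT_comp (mr k) (measurable_snd).
have F0 z : (0 <= F z)%E by rewrite lee_fin powR_ge0.
have -> : (\int[Pr]_w ((\sum_(k <- s) u k * \prod_(i < n.+1) r k (Y i w)) `^ a)%:E
    = \int[Pr]_w F ((w : past Y n), Y n w))%E.
  apply: eq_integral => w _; rewrite /F; congr ((_ `^ a)%:E).
  by apply: eq_bigr => k _; rewrite big_ord_recr/= mulrA.
rewrite (iid_tonelli Y_iid mF F0).
apply: (@le_trans _ _ (\int[Pr]_w (c%:E * (S w `^ a)%:E))%E).
  apply: le_ge0_integral => w _; first by apply: integral_ge0 => x _; exact: F0.
  rewrite -EFinM /F /=.
  apply: (rc (fun k => u k * \prod_(i < n) r k (Y i w))) => k.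
  by rewrite mulr_ge0//; apply: prodr_ge0.
have mS : measurable_fun setT S.
  apply: measurable_sum => k; apply: measurable_funM => //.
  by apply: measurable_prod => i _; exact: measurableT_comp.
rewrite ge0_integralZl_EFin//; last 2 first.
- by move=> w _; rewrite lee_fin powR_ge0.
- by apply/measurable_EFinP; exact: measurable_powR_comp.
rewrite exprS mulrCA EFinM; apply: lee_pmul => //; last exact: IHn.
by apply: integral_ge0 => w _; rewrite lee_fin powR_ge0.
Qed.

Lemma integral_sum_sqr_centered (h : X -> R) (V : R) :
  measurable_fun setT h -> P0.-integrable setT (EFin \o h) ->
  (\int[P0]_x (h x)%:E = 0)%E -> (\int[P0]_x (h x ^+ 2)%:E <= V%:E)%E ->
  forall n, (\int[Pr]_w ((\sum_(i < n) h (Y i w)) ^+ 2)%:E <=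
             (n%:R * V)%:E)%E.
Proof.
move=> mh ih h0 hV; elim=> [|n IHn].
  under eq_integral do rewrite big_ord0 expr0n/=.
  by rewrite probability_integral_cst mul0r.
pose S (w : Omega) := \sum_(i < n) h (Y i w).
pose F (z : past Y n * X) :=
  ((\sum_(i < n) h (Y i z.1) + h z.2) ^+ 2)%:E.
have mF : measurable_fun setT F.
  apply/measurable_EFinP; apply: measurable_funX; apply: measurable_funD.
    by apply: measurable_sum => i; exact: measurable_past_comp.
  exact: measurableT_comp mh (measurable_snd).
have F0 z : (0 <= F z)%E by rewrite lee_fin sqr_ge0.
have -> : (\int[Pr]_w ((\sum_(i < n.+1) h (Y i w)) ^+ 2)%:E
    = \int[Pr]_w F ((w : past Y n), Y n w))%E.
  by apply: eq_integral => w _; rewrite /F big_ord_recr.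
rewrite (iid_tonelli Y_iid mF F0).
have ih2 : P0.-integrable setT (EFin \o (fun x => h x ^+ 2)).
  apply/integrableP; split; first by apply/measurable_EFinP; exact: measurable_funX.
  under eq_integral do rewrite /= ger0_norm ?sqr_ge0//.
  by rewrite (le_lt_trans hV)// ltry.
have mS : measurable_fun setT S.
  by apply: measurable_sum => k; exact: measurableT_comp.
apply: (@le_trans _ _ (\int[Pr]_w ((S w ^+ 2)%:E + V%:E))%E).
  apply: le_ge0_integral => w _; first by apply: integral_ge0 => x _; exact: F0.
  rewrite /F/= -/(S w).
  have -> : (\int[P0]_x ((S w + h x) ^+ 2)%:E =
      \int[P0]_x ((cst (S w ^+ 2)%:E \+
        ((fun x => (S w *+ 2)%:E * (h x)%:E) \+
         (EFin \o (fun x => h x ^+ 2)%R))) x))%E.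
    apply: eq_integral => x _ /=; rewrite -EFinM -!EFinD; congr (_%:E).
    by ring.
  have i1 : P0.-integrable setT (cst (S w ^+ 2)%:E).
    exact: finite_measure_integrable_cst.
  have i2 : P0.-integrable setT (fun x => (S w *+ 2)%:E * (h x)%:E)%E.
    exact: integrableZl.
  rewrite integralD//; last exact: integrableD.
  rewrite integralD// integralZl// [X in (_ * X)%E]h0 mule0 add0e.
  rewrite leeD//.
  by rewrite (probability_integral_cst P0 (S w ^+ 2)%:E).
rewrite ge0_integralD//; last 3 first.
- by move=> w _; rewrite lee_fin sqr_ge0.
- by apply/measurable_EFinP; exact: measurable_funX.
- move=> w _; apply: le_trans hV; apply: integral_ge0 => x _.
  by rewrite lee_fin sqr_ge0.
rewrite probability_integral_cst -natr1 mulrDl mul1r EFinD leeD//.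
Qed.

Lemma iid_lower_tail (f : X -> R) (e C : R) n :
  measurable_fun setT f -> 0 < e -> 0 < C -> (0 < n)%N ->
  (\int[P0]_x (f x ^+ 2)%:E <= e%:E)%E ->
  ((- e)%:E <= \int[P0]_x (f x)%:E)%E ->
  (Pr [set w | (\sum_(i < n) f (Y i w) < - (n%:R * e * (1 + C)))%R] <=
   ((n%:R * e * C ^+ 2)^-1)%:E)%E.
Proof.
move=> mf e0 C0 n0 f2 f1.
have n0R : 0 < n%:R :> R by rewrite ltr0n.
have if2 : P0.-integrable setT (EFin \o (fun x => f x ^+ 2)).
  apply/integrableP; split; first by apply/measurable_EFinP; exact: measurable_funX.
  under eq_integral do rewrite /= ger0_norm ?sqr_ge0//.
  by rewrite (le_lt_trans f2)// ltry.
have i1 (c : R) : P0.-integrable setT (EFin \o cst c).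
  exact: finite_measure_integrable_cst.
have if1 : P0.-integrable setT (EFin \o f).
  apply: (@le_integrable _ _ _ _ _ measurableT _
    (EFin \o (fun x => 1 + f x ^+ 2))%R); first exact/measurable_EFinP.
    move=> x _ /=; rewrite lee_fin [leRHS]ger0_norm ?addr_ge0 ?sqr_ge0//.
    by rewrite ler_norml; apply/andP; split; nra.
  rewrite [X in _.-integrable _ X](_ : _ =
    (EFin \o cst 1%R) \+ (EFin \o (fun x => f x ^+ 2)%R))%E//.
  exact: integrableD.
have /fineK mE := integrable_fin_num measurableT if1.
set m := fine _ in mE.
pose h x := f x - m.
have mh : measurable_fun setT h by exact: measurable_funB.
have ih : P0.-integrable setT (EFin \o h).
  rewrite [X in _.-integrable _ X](_ : _ = (EFin \o f) \- (EFin \o cst m))%E//.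
  exact: integrableB.
have h0 : (\int[P0]_x (h x)%:E = 0)%E.
  rewrite (_ : (fun x => (h x)%:E) = (EFin \o f) \- (EFin \o cst m))%E//.
  rewrite integralB// (probability_integral_cst P0 m%:E) -mE.
  by rewrite subee.
have hV : (\int[P0]_x (h x ^+ 2)%:E <= e%:E)%E.
  have hE : (\int[P0]_x (h x ^+ 2)%:E + (m ^+ 2)%:E = \int[P0]_x (f x ^+ 2)%:E)%E.
    have -> : (\int[P0]_x (h x ^+ 2)%:E = \int[P0]_x
        (((EFin \o (fun x => f x ^+ 2)%R) \+
         ((fun x => (- (m *+ 2))%:E * (f x)%:E) \+
          (EFin \o cst (m ^+ 2)%R))) x))%E.
      apply: eq_integral => x _ /=; rewrite -EFinM -!EFinD; congr (_%:E).
      by rewrite /h; ring.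
    have i2 : P0.-integrable setT (fun x => (- (m *+ 2))%:E * (f x)%:E)%E.
      exact: integrableZl.
    rewrite integralD//; last exact: integrableD.
    rewrite integralD// integralZl// [X in (_ * X)%E](_ : _ = m%:E);
      last by rewrite mE.
    rewrite (probability_integral_cst P0 (m ^+ 2)%:E) -addeA.
    rewrite -EFinM -!EFinD [X in (_ + X%:E)%E](_ : _ = 0) ?adde0//.
    by ring.
  by apply: le_trans f2; rewrite -hE leeDl// lee_fin sqr_ge0.
have me : - e <= m by rewrite -lee_fin mE.
have mfY : measurable_fun setT (fun w => \sum_(i < n) f (Y i w)).
  by apply: measurable_sum => i; exact: measurableT_comp.
set A := [set w | _].
have mA : measurable A.
  rewrite /A -[X in measurable X]setTI; under eq_set do rewrite -lte_fin.
  apply: emeasurable_fun_infty_o => //; exact/measurable_EFinP.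
pose b := n%:R * e * C.
have b0 : 0 < b by rewrite !mulr_gt0.
have := integral_sum_sqr_centered mh ih h0 hV n.
move=> /(le_trans (@ge0_markov _ _ _ Pr _ A (b ^+ 2) _ mA _ _)) H.
have {}H : ((b ^+ 2)%:E * Pr A <= (n%:R * e)%:E)%E.
  apply: H; [by move=> w; rewrite lee_fin sqr_ge0|exact: sqr_ge0|].
  move=> w; rewrite /A/= => Aw; rewrite lee_fin /h.
  rewrite sumrB sumr_const card_ord -[m *+ n]mulr_natl.
  set S := \sum_(i < n) _ in Aw *.
  have Sb : b <= - (S - n%:R * m).
    have : n%:R * - e <= n%:R * m by rewrite ler_pM2l.
    by rewrite /b; lra.
  rewrite -[X in _ <= X]sqrrN; apply: lerXn2r => //; rewrite nnegrE ltW//.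
  exact: lt_le_trans Sb.
have PrA : Pr A \is a fin_num by exact: fin_num_measure.
rewrite -(fineK PrA) -EFinM lee_fin in H.
rewrite -(fineK PrA) lee_fin.
rewrite -(ler_pM2l (exprn_gt0 2 b0)); apply: (le_trans H).
rewrite /b le_eqVlt; apply/orP; left; apply/eqP; field.
by rewrite !gt_eqF.
Qed.

End iid_consequences.

(** * Finite averages approximating an integral *)

Section empirical_approximation.
Context {R : realType}.
Context {dO : measure_display} {Omega : measurableType dO}.
Context {dM : measure_display} {M : measurableType dM}.
Variables (Pr : probability Omega R) (Q : probability M R).
Variables (g : Omega -> M -> R) (K : R) (S : set M).
Hypothesis mg : measurable_fun setT (fun z : Omega * M => g z.1 z.2).
Hypothesis g0K : forall w t, 0 <= g w t <= K.
Hypothesis mS : measurable S.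
Hypothesis QS : Q S = 1%E.

Let G (w : Omega) : R := fine (\int[Q]_t (g w t)%:E)%E.

Let mg1 w : measurable_fun setT (g w).
Proof. exact: (measurableT_comp mg (measurable_pair1 w)). Qed.

Let GE w : (\int[Q]_t (g w t)%:E = (G w)%:E)%E.
Proof.
rewrite fineK// ge0_fin_numE; last first.
  by apply: integral_ge0 => t _; rewrite lee_fin; case/andP: (g0K w t).
apply: (@le_lt_trans _ _ (\int[Q]_t K%:E)%E).
  by apply: le_ge0_integral => t _; rewrite lee_fin; case/andP: (g0K w t).
by rewrite probability_integral_cst ltry.
Qed.

Let mG : measurable_fun setT G.
Proof.
apply: measurableT_comp; first exact: fine_measurable.
apply: (measurable_fun_fubini_tonelli_F (fun z : Omega * M => (g z.1 z.2)%:E)).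
  exact/measurable_EFinP.
by move=> z; rewrite lee_fin; case/andP: (g0K z.1 z.2).
Qed.

Let step (D : R) w :
  (\int[Q]_t ((D + (g w t - G w)) ^+ 2)%:E <= (D ^+ 2 + K ^+ 2)%:E)%E.
Proof.
pose a := D - G w.
have ig : Q.-integrable setT (EFin \o g w).
  apply: (@le_integrable _ _ _ _ _ measurableT _ (cst K%:E)).
  - exact/measurable_EFinP.
  - move=> t _ /=; rewrite lee_fin; have /andP[g0 gK] := g0K w t.
    by rewrite !ger0_norm// (le_trans g0).
  - exact: finite_measure_integrable_cst.
have ic (c : R) : Q.-integrable setT (cst c%:E).
  exact: finite_measure_integrable_cst.
apply: (@le_trans _ _
    (\int[Q]_t ((cst (a ^+ 2 + K ^+ 2)%:E \+
      (fun t => (a *+ 2)%:E * (g w t)%:E)) t))%E).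
  apply: le_ge0_integral => t _; rewrite ?lee_fin ?sqr_ge0//=.
  have /andP[g0 gK] := g0K w t.
  have : g w t ^+ 2 <= K ^+ 2 by rewrite lerXn2r// nnegrE// (le_trans g0).
  by rewrite /a; nra.
rewrite integralD//; last exact: integrableZl.
rewrite integralZl// GE (probability_integral_cst Q (a ^+ 2 + K ^+ 2)%:E).
rewrite -EFinM -EFinD lee_fin /a.
have := sqr_ge0 (G w); nra.
Qed.

(* Maurey's empirical method: the sample is chosen greedily, so that no product
   measure is needed. *)
Lemma empirical_sample m : exists t : nat -> M, (forall k, S (t k)) /\
  (\int[Pr]_w ((\sum_(k < m) (g w (t k) - G w)) ^+ 2)%:E <=
   (m%:R * (K ^+ 2 + 1))%:E)%E.
Proof.
elim: m => [|m [t [St IHm]]].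
  have [s Ss] : S !=set0.
    apply/set0P/eqP => S0; move: QS; rewrite S0 measure0 => /esym/eqP.
    by rewrite onee_eq0.
  exists (fun=> s); split => //.
  under eq_integral do rewrite big_ord0 expr0n/=.
  by rewrite probability_integral_cst mul0r.
pose D w := \sum_(k < m) (g w (t k) - G w).
have mD : measurable_fun setT D.
  apply: measurable_sum => k; apply: measurable_funB => //.
  exact: (measurableT_comp mg (measurable_pair2 (t k))).
pose F (z : Omega * M) := ((D z.1 + (g z.1 z.2 - G z.1)) ^+ 2)%:E.
have mF : measurable_fun setT F.
  apply/measurable_EFinP; apply: measurable_funX; apply: measurable_funD.
    exact: measurableT_comp.
  by apply: measurable_funB => //; exact: measurableT_comp mG (measurable_fst).
have F0 z : (0 <= F z)%E by rewrite lee_fin sqr_ge0.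
pose c := m.+1%:R * (K ^+ 2 + 1).
have [[s Ss sc]|nex] := pselect (exists2 s, S s & (\int[Pr]_w F (w, s) <= c%:E)%E).
  exists (fun k => if k == m then s else t k); split.
    by move=> k; case: ifP.
  apply: le_trans sc; apply: le_ge0_integral => w _.
    by rewrite lee_fin sqr_ge0.
  rewrite lee_fin /= big_ord_recr/= eqxx le_eqVlt; apply/orP; left; apply/eqP.
  congr ((_ + _) ^+ 2); apply: eq_bigr => k _.
  by rewrite ltn_eqF.
have c0 : 0 <= c by rewrite mulr_ge0// addr_ge0// sqr_ge0.
have lb : (c%:E * Q S <= \int[Q]_s \int[Pr]_w F (w, s))%E.
  apply: ge0_markov => //; first by move=> s; apply: integral_ge0.
  move=> s Ss; rewrite leNgt; apply/negP => /ltW sc.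
  by apply: nex; exists s.
have ub : (\int[Q]_s \int[Pr]_w F (w, s) <=
    (m%:R * (K ^+ 2 + 1) + K ^+ 2)%:E)%E.
  rewrite -(fubini_tonelli F)//.
  apply: (@le_trans _ _ (\int[Pr]_w ((D w ^+ 2)%:E + (K ^+ 2)%:E))%E).
    apply: le_ge0_integral => w _; first by apply: integral_ge0.
    by rewrite -EFinD; exact: (step (D w) w).
  rewrite ge0_integralD//; last 3 first.
  - by move=> w _; rewrite lee_fin sqr_ge0.
  - by apply/measurable_EFinP; exact: measurable_funX.
  - by move=> w _; rewrite lee_fin sqr_ge0.
  by rewrite probability_integral_cst EFinD leeD.
have := le_trans lb ub; rewrite QS mule1 lee_fin /c -natr1; lra.
Qed.

Lemma empirical_average_L1 m : exists t : nat -> M, (forall k, S (t k)) /\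
  (\int[Pr]_w (`|\sum_(k < m.+1) (g w (t k) - G w)| / m.+1%:R)%:E <=
   ((K ^+ 2 + 2) / Num.sqrt m.+1%:R)%:E)%E.
Proof.
have [t [St tP]] := empirical_sample m.+1; exists t; split => //.
set D := fun w => \sum_(k < m.+1) (g w (t k) - G w) in tP *.
set q : R := m.+1%:R.
set s := Num.sqrt q.
have q0 : 0 < q by rewrite ltr0n.
have s0 : 0 < s by rewrite sqrtr_gt0.
have sq : s ^+ 2 = q by rewrite sqr_sqrtr// ltW.
have mD : measurable_fun setT D.
  apply: measurable_sum => k; apply: measurable_funB => //.
  exact: (measurableT_comp mg (measurable_pair2 (t k))).
apply: (@le_trans _ _ (\int[Pr]_w ((s * q)^-1 * D w ^+ 2 + s^-1 * cst 1 w)%:E)%E).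
  apply: le_ge0_integral => w _; first by rewrite lee_fin divr_ge0.
  rewrite lee_fin.
  rewrite ler_pdivrMr//= mulr1.
  have -> : ((s * q)^-1 * D w ^+ 2 + s^-1) * q = s^-1 * (D w ^+ 2 + q).
    by field; rewrite !gt_eqF.
  rewrite ler_pdivlMl// -sq -(real_normK (num_real (D w))).
  by have := sqr_ge0 (s - `|D w|); have := normr_ge0 (D w); nra.
rewrite ge0_integral_lin2//; last 4 first.
- exact: measurable_funX.
- by move=> w; exact: sqr_ge0.
- by rewrite invr_ge0 mulr_ge0// ltW.
- by rewrite invr_ge0 ltW.
rewrite (probability_integral_cst Pr 1%:E) mule1.
apply: (@le_trans _ _ ((s * q)^-1%:E * (q * (K ^+ 2 + 1))%:E + s^-1%:E)%E).
  by rewrite leeD// lee_wpmul2l// lee_fin invr_ge0 mulr_ge0// ltW.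
rewrite -EFinM -EFinD lee_fin le_eqVlt; apply/orP; left; apply/eqP.
by field; rewrite !gt_eqF.
Qed.
End empirical_approximation.

(** * The testing index on convex hulls *)

Definition mix_closed (T : Type) (R : realType) (C : set (T -> R)) : Prop :=
  forall (f g : T -> R) (t : R), C f -> C g -> 0 <= t <= 1 ->
    C (fun x => t * f x + (1 - t) * g x).

Lemma mix_closed_combination (T : Type) (R : realType) (C : set (T -> R))
    (I : eqType) (s : seq I) (q : I -> T -> R) (v : I -> R) :
  mix_closed C -> (forall k, k \in s -> C (q k)) -> (forall k, 0 <= v k) ->
  0 < \sum_(k <- s) v k ->
  exists2 f, C f & forall x,
    \sum_(k <- s) v k * q k x = (\sum_(k <- s) v k) * f x.
Proof.
move=> mixC + v0; elim: s => [|k s IHs] Cq; first by rewrite big_nil ltxx.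
have Ck : C (q k) by apply: Cq; rewrite mem_head.
rewrite big_cons; set V := \sum_(j <- s) v j => vV.
have V0 : 0 <= V by exact: sumr_ge0.
have [V_eq0|V_neq0] := eqVneq V 0.
  exists (q k) => // x; rewrite big_cons V_eq0 addr0 big_seq big1 ?addr0//.
  move=> j js; suff -> : v j = 0 by rewrite mul0r.
  apply/eqP; rewrite eq_le v0 andbT -V_eq0 /V (big_rem j)//= lerDl.
  exact: sumr_ge0.
have {V_neq0} V_gt0 : 0 < V by rewrite lt_neqAle eq_sym V_neq0.
have [f Cf fE] := IHs (fun j js => Cq j (mem_behead (s := k :: s) js)) V_gt0.
exists (fun x => v k / (v k + V) * q k x + (1 - v k / (v k + V)) * f x).
  apply: mixC => //; apply/andP; split; first by rewrite divr_ge0// ltW.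
  by rewrite ler_pdivrMr// mul1r lerDl.
by move=> x; rewrite big_cons fE -/V; field; rewrite gt_eqF.
Qed.

Lemma ge0_integrable_sum d (X : measurableType d) (R : realType)
    (Q : probability X R) (I : eqType) (s : seq I) (f : I -> X -> R) :
  (forall k, k \in s -> ge0_integrable Q (f k)) ->
  ge0_integrable Q (fun x => \sum_(k <- s) f k x).
Proof.
elim: s => [_|k s IHs int].
  under eq_fun do rewrite big_nil.
  by split => //; rewrite integral0.
have [mk k0 koo] := int k (mem_head k s).
have [ms s0 soo] := IHs (fun j js => int j (mem_behead (s := k :: s) js)).
under eq_fun do rewrite big_cons.
split; [exact: measurable_funD|by move=> x; rewrite addr_ge0|].
under eq_integral do rewrite -[f k _]mul1r -[X in _ + X]mul1r.
by rewrite ge0_integral_lin2// !mul1e lte_add_pinfty.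
Qed.

Section probability_mixture.
Context {R : realType} {d : measure_display} {X : measurableType d}.
Variables (Q1 Q2 : probability X R) (s t : {nonneg R}).
Hypothesis st1 : s%:num + t%:num = 1.

Definition pmix := measure_add (mscale s Q1) (mscale t Q2).

HB.instance Definition _ := Measure.on pmix.

Let pmix_setT : pmix [set: X] = 1%E.
Proof.
transitivity (s%:num%:E * Q1 setT + t%:num%:E * Q2 setT)%E.
  exact: measure_addE.
by rewrite !probability_setT !mule1 -EFinD st1.
Qed.

HB.instance Definition _ := Measure_isProbability.Build _ _ _ pmix pmix_setT.

End probability_mixture.

Section testing_index.
Context {R : realType} {dX : measure_display} {X : measurableType dX}.
Variables (mu : {measure set X -> \bar R}) (P0 : probability X R).
Variables (ps : X -> R).

Definition densities_of (B : set (probability X R)) : set (X -> R) :=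
  [set q | exists2 Q, B Q & is_density mu Q q].

Lemma densities_of_mix_closed B :
  convex_measures B -> mix_closed (densities_of B).
Proof.
move=> cvxB q1 q2 t [Q1 BQ1 [m1 q10 Q1E]] [Q2 BQ2 [m2 q20 Q2E]] t01.
have [t0 t1] := andP t01.
have s0 : 0 <= 1 - t by rewrite subr_ge0.
have st : (NngNum t0)%:num + (NngNum s0)%:num = 1 by rewrite /= addrC subrK.
have QE A : (pmix Q1 Q2 (NngNum t0) (NngNum s0) A =
    t%:E * Q1 A + (1 - t)%:E * Q2 A)%E by exact: measure_addE.
pose Q : probability X R := pmix Q1 Q2 (NngNum t0) (NngNum s0).
exists (Q st); first by apply: (cvxB Q1 Q2 _ t) => // A _; exact: QE.
split.
- by apply: measurable_funD; exact: measurable_funM.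
- by move=> x; rewrite addr_ge0// mulr_ge0.
move=> A mA; rewrite [LHS]QE Q1E// Q2E//.
under [RHS]eq_integral do rewrite EFinD !EFinM.
have mE (f : X -> R) : measurable_fun setT f -> measurable_fun A (EFin \o f).
  by move=> mf; apply/measurable_EFinP; exact: measurable_funS mf.
rewrite ge0_integralD//; last 4 first.
- by move=> x _; rewrite -EFinM lee_fin mulr_ge0.
- by apply: (mE (fun x => t * q1 x)); exact: measurable_funM.
- by move=> x _; rewrite -EFinM lee_fin mulr_ge0.
- by apply: (mE (fun x => (1 - t) * q2 x)); exact: measurable_funM.
by rewrite !ge0_integralZl_EFin//; do ?[by move=> x _; rewrite lee_fin|exact: mE].
Qed.

Lemma testing_index_power_mean B (e c : R) q :
  has_testing_index_ge mu P0 ps B e%:E -> expR (- e) < c ->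
  densities_of B q ->
  exists2 a, 0 < a < 1 & (power_mean P0 (fun x => q x / ps x)%R a < c%:E)%E.
Proof.
move=> Bc ec Dq; have c0 : 0 < c by apply: lt_trans ec; exact: expR_gt0.
have : ((- ln c)%:E < testing_index P0 ps q)%E.
  apply: (@lt_le_trans _ _ e%:E).
    by rewrite lte_fin ltrNl -[ltLHS]expRK ltr_ln ?posrE// expR_gt0.
  by apply: le_trans Bc _; apply: ereal_inf_lbound; exists q.
move=> /ereal_sup_gt[_ [a a01 <-] lt_a]; exists a => //; move: lt_a.
rewrite -/(power_mean P0 (fun x => q x / ps x) a).
have := power_mean_ge0 P0 (fun x => q x / ps x) a.
case: (power_mean _ _ _) => [r r0|//|//] /=.
case: ifPn => [r_le0 _|]; first by rewrite lte_fin (le_lt_trans r_le0).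
rewrite -ltNge => r_gt0; rewrite -EFinN !lte_fin ltrN2.
by rewrite ltr_ln.
Qed.

Lemma hull_uniform_exponent (D : set (X -> R)) (I : eqType) (s : seq I)
    (q : I -> X -> R) (c rho : R) :
  0 < c < rho -> mix_closed D ->
  measurable_fun setT ps -> (forall x, 0 <= ps x) ->
  (forall f, D f -> measurable_fun setT f /\ forall x, 0 <= f x) ->
  (forall f, D f -> exists2 a, 0 < a < 1 &
     (power_mean P0 (fun x => f x / ps x)%R a < c%:E)%E) ->
  (forall k, k \in s -> D (q k)) ->
  (forall k, k \in s -> \int[P0]_x (q k x / ps x)%:E < +oo)%E ->
  exists2 a, 0 < a <= 1 & forall v : I -> R, (forall k, 0 <= v k) ->
    (\int[P0]_x ((\sum_(k <- s) v k * (q k x / ps x)) `^ a)%:E <=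
     (rho * (\sum_(k <- s) v k) `^ a)%:E)%E.
Proof.
move=> /andP[c0 crho] mixD mps ps0 Dfun Dtest Dq qfin.
have rho0 : 0 < rho by exact: lt_trans crho.
have ips0 x : 0 <= (ps x)^-1 by rewrite invr_ge0.
have mips : measurable_fun setT (fun x => (ps x)^-1).
  under eq_fun do rewrite -powR_inv1//.
  exact: measurable_powR_comp.
have [s0|s_neq0] := eqVneq s [::].
  exists 1; first by rewrite ltr01 lexx.
  move=> v v0; rewrite s0 big_nil powR0 ?oner_neq0// mulr0.
  under eq_integral do rewrite big_nil powR0 ?oner_neq0//.
  by rewrite integral0.
pose sz : R := (size s)%:R.
have sz1 : 1 <= sz by rewrite /sz ler1n lt0n size_eq0.
have sz0 : 0 < sz by exact: lt_le_trans sz1.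
pose T x := \sum_(k <- s) (q k x / ps x).
have sumq v : (forall k : I, 0 <= v k) -> 0 < \sum_(k <- s) v k ->
    exists2 f, D f & forall x, \sum_(k <- s) v k * (q k x / ps x) =
      (\sum_(k <- s) v k) * (f x / ps x).
  move=> v0 V0; have [f Df fE] := mix_closed_combination mixD Dq v0 V0.
  exists f => // x; rewrite mulrA -fE mulr_suml.
  by apply: eq_bigr => k _; rewrite mulrA.
have sum1 : \sum_(k <- s) (1 : R) = sz.
  by rewrite big_const_seq count_predT iter_addr addr0.
have [u Du uE] : exists2 f, D f & forall x, T x = sz * (f x / ps x).
  have [//||f Df fE] := @sumq (fun=> 1); first by rewrite sum1.
  by exists f => // x; rewrite -sum1 -fE; apply: eq_bigr => k _; rewrite mul1r.
have q0 k x : k \in s -> 0 <= q k x / ps x.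
  by move=> ks; rewrite mulr_ge0//; have [_] := Dfun _ (Dq _ ks); apply.
have mq k : k \in s -> measurable_fun setT (fun x => q k x / ps x).
  by move=> ks; apply: measurable_funM => //; have [] := Dfun _ (Dq _ ks).
have iq k : k \in s -> ge0_integrable P0 (fun x => q k x / ps x).
  by move=> ks; split; [exact: mq|move=> x; exact: q0|exact: qfin].
have [mT T0 Tfin] : ge0_integrable P0 T by exact: ge0_integrable_sum.
pose C : set (X -> R) :=
  [set r | [/\ exists2 f, D f & r = (fun x => f x / ps x),
               forall x, 0 <= r x & forall x, r x <= T x]].
have Cint r : C r -> ge0_integrable P0 r.
  move=> [[f Df rE] r0 rT]; split => //.
    by rewrite rE; apply: measurable_funM => //; have [] := Dfun _ Df.
  by apply: le_lt_trans Tfin; apply: le_ge0_integral => x _; rewrite lee_fin.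
have [|||||||a a01 Ca] := @uniform_exponent R dX X P0 C
  (fun x => u x / ps x) sz c rho.
- by rewrite c0.
- exact: sz1.
- split; [by exists u|by move=> x; rewrite mulr_ge0//; have [_] := Dfun _ Du; apply|].
  by move=> x; rewrite uE ler_peMl// mulr_ge0//; have [_] := Dfun _ Du; apply.
- exact: Cint.
- by move=> r [_ _ rT] x; rewrite -uE.
- move=> r1 r2 t [[f1 D1 ->] r10 r1T] [[f2 D2 ->] r20 r2T] t01.
  have [t0 t1] := andP t01; split.
  + exists (fun x => t * f1 x + (1 - t) * f2 x); first exact: mixD.
    by apply/funext => x; ring.
  + by move=> x; rewrite addr_ge0// mulr_ge0// subr_ge0.
  + by move=> x; have := r1T x; have := r2T x; nra.
- by move=> r [[f Df ->] _ _]; exact: Dtest.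
exists a => // v v0; have [a0 a1] := andP a01.
set V := \sum_(k <- s) v k.
have V0 : 0 <= V by exact: sumr_ge0.
have [V_eq0|V_neq0] := eqVneq V 0.
  rewrite V_eq0 powR0 ?gt_eqF// mulr0 integral0_eq// => x _.
  rewrite big_seq big1 ?powR0 ?gt_eqF// => k ks.
  suff -> : v k = 0 by rewrite mul0r.
  apply/eqP; rewrite eq_le v0 andbT -V_eq0 /V (big_rem k)//= lerDl.
  exact: sumr_ge0.
have V_gt0 : 0 < V by rewrite lt_neqAle eq_sym V_neq0.
have [f Df fE] := sumq v v0 V_gt0.
have f0 x : 0 <= f x / ps x.
  by rewrite mulr_ge0//; have [_] := Dfun _ Df; apply.
have Cf : C (fun x => f x / ps x).
  split; [by exists f|by []|move=> x].
  rewrite -(ler_pM2l V_gt0) -fE /T mulr_sumr big_seq [leRHS]big_seq.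
  apply: ler_sum => k ks; apply: ler_wpM2r; first exact: q0.
  by rewrite /V (big_rem k)//= lerDl; exact: sumr_ge0.
under eq_integral do rewrite fE powRM// EFinM.
rewrite ge0_integralZl_EFin ?powR_ge0//; last 2 first.
- by move=> x _; rewrite lee_fin powR_ge0.
- apply/measurable_EFinP; apply: measurable_powR_comp.
  by have [] := Cint _ Cf.
rewrite mulrC EFinM; apply: lee_pmul => //; first by rewrite lee_fin powR_ge0.
  by apply: integral_ge0 => x _; rewrite lee_fin powR_ge0.
exact: Ca.
Qed.

End testing_index.

(** * Likelihood ratios over a covered set *)

Lemma minr1_sum_le (R : realType) (I : Type) (s : seq I) (x : I -> R) :
  (forall i, 0 <= x i) ->
  Num.min 1 (\sum_(i <- s) x i) <= \sum_(i <- s) Num.min 1 (x i).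
Proof.
move=> x0; elim: s => [|i s IHs]; first by rewrite !big_nil ge_min lexx orbT.
rewrite !big_cons; have S0 : 0 <= \sum_(j <- s) x j by exact: sumr_ge0.
apply: (@le_trans _ _ (Num.min 1 (x i) + Num.min 1 (\sum_(j <- s) x j))).
  set S := \sum_(j <- s) x j in S0 *.
  have m1 : Num.min 1 (x i + S) <= 1 by rewrite ge_min lexx.
  have mS : Num.min 1 (x i + S) <= x i + S by rewrite ge_min lexx orbT.
  have m0 : 0 <= Num.min 1 S by rewrite le_min ler01.
  have m0i : 0 <= Num.min 1 (x i) by rewrite le_min ler01 x0.
  have [x1|x1] := leP 1 (x i); first by lra.
  by have [S1|S1] := leP 1 S; have := x0 i; lra.
by rewrite lerD2l.
Qed.

Lemma minr1_le_powR (R : realType) (y a : R) :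
  0 <= y -> 0 < a <= 1 -> Num.min 1 y <= y `^ a.
Proof.
move=> y0 /andP[a0 a1]; have [y1|y1] := leP 1 y.
  have <- : 1 `^ a = 1 :> R by rewrite powR1.
  by apply: ge0_ler_powR; rewrite ?nnegrE// ltW.
have [->|y_neq0] := eqVneq y 0; first by rewrite powR0// gt_eqF.
by apply: ger1_powR => //; rewrite lt_neqAle eq_sym y_neq0 y0 ltW.
Qed.

Lemma conditional_probability d (T : measurableType d) (R : realType)
    (Q0 : probability T R) (S : set T) : measurable S -> (0 < Q0 S)%E ->
  exists Q : probability T R, Q S = 1%E /\
    forall f : T -> \bar R, measurable_fun setT f -> (forall t, 0 <= f t)%E ->
      (\int[Q0]_(t in S) f t = Q0 S * \int[Q]_t f t)%E.
Proof.
move=> mS QS0.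
have QSfin : Q0 S \is a fin_num by exact: fin_num_measure.
have pi0 : 0 < fine (Q0 S) by rewrite fine_gt0// QS0/= ltey_eq QSfin.
have pii0 : 0 <= (fine (Q0 S))^-1 by rewrite invr_ge0 ltW.
pose Q : probability T R := mnormalize (mrestr Q0 mS) Q0.
have QE A : Q A = (Q0 (A `&` S) * (fine (Q0 S))^-1%:E)%E.
  rewrite /Q /= /mnormalize /= {1 2 4}/mrestr setTI gt_eqF//=.
  by rewrite lt_eqF// ltey_eq QSfin.
exists Q; split.
  by rewrite QE setIid -{1}(fineK QSfin) -EFinM divff// gt_eqF.
move=> f mf f0.
have QSc := QE (~` S); rewrite setICl measure0 mul0e in QSc.
rewrite [in RHS](ge0_negligible_integral (measurableC mS) _ _ _ QSc)//.
rewrite setTD setCK.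
have -> : (\int[Q]_(t in S) f t = \int[mscale (NngNum pii0) Q0]_(t in S) f t)%E.
  apply: eq_measure_integral => A mA AS; rewrite [LHS](QE A).
  by rewrite (_ : A `&` S = A); [exact: muleC|exact/setIidPl].
rewrite ge0_integral_mscale//; last exact: measurable_funS mf.
by rewrite muleA -{1}(fineK QSfin) -EFinM divff ?gt_eqF// mul1e.
Qed.

Lemma cvg_mine_le (R : realType) (u : (\bar R)^nat) (l x : \bar R) :
  u n @[n --> \oo] --> l -> (forall n, u n <= l)%E ->
  mine x (u n) @[n --> \oo] --> mine x l.
Proof.
move=> ul u_le; have [xl|lx] := ltP x l.
  have xu : \forall n \near \oo, (x < u n)%E := ul _ (open_ereal_gt' xl).
  by apply: cvg_near_cst; apply: filterS xu => n xu; apply/min_idPl; exact: ltW.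
rewrite (_ : (fun n => mine x (u n)) = u)//; apply/funext => n.
by apply/min_idPr; exact: le_trans (u_le n) lx.
Qed.

Section likelihood_ratio.
Context {R : realType} {dX : measure_display} {X : measurableType dX}.
Context {dM : measure_display} {M : measurableType dM}.
Context {dO : measure_display} {Omega : measurableType dO}.
Variables (mu : {measure set X -> \bar R}) (P0 : probability X R).
Variables (P : M -> probability X R) (p : M -> X -> R) (ts : M).
Hypothesis p_density : forall t, is_density mu (P t) (p t).
Hypothesis p_measurable : measurable_fun setT (fun z : X * M => p z.2 z.1).
Hypothesis ratio_finite :
  forall t, (\int[P0]_x (p t x / p ts x)%:E < +oo)%E.
Variables (Pr : probability Omega R) (Y : nat -> Omega -> X).
Hypothesis Y_iid : iid Pr P0 Y.

Definition lik_ratio (n : nat) (w : Omega) (t : M) : R :=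
  \prod_(i < n) (p t (Y i w) / p ts (Y i w)).

Let mY i : measurable_fun setT (Y i). Proof. exact: measurable_obs Y_iid i. Qed.

Lemma density_ge0 t x : 0 <= p t x. Proof. by have [_] := p_density t. Qed.

Lemma measurable_density t : measurable_fun setT (p t).
Proof. by have [] := p_density t. Qed.

Lemma ratio_ge0 t x : 0 <= p t x / p ts x.
Proof. by rewrite divr_ge0 ?density_ge0. Qed.

Lemma measurable_ratio :
  measurable_fun setT (fun z : X * M => p z.2 z.1 / p ts z.1).
Proof.
apply: measurable_funM => //.
under eq_fun do rewrite -powR_inv1 ?density_ge0//.
apply: measurable_powR_comp.
exact: measurableT_comp (measurable_density ts) (measurable_fst).
Qed.

Lemma measurable_ratio1 t : measurable_fun setT (fun x => p t x / p ts x).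
Proof. exact: measurableT_comp measurable_ratio (measurable_pair2 t). Qed.

Lemma lik_ratio_ge0 n w t : 0 <= lik_ratio n w t.
Proof. by apply: prodr_ge0 => i _; exact: ratio_ge0. Qed.

Lemma measurable_lik_ratio n :
  measurable_fun setT (fun z : Omega * M => lik_ratio n z.1 z.2).
Proof.
apply: measurable_prod => i _.
apply: (@measurableT_comp _ _ _ _ _ _ (fun z : X * M => p z.2 z.1 / p ts z.1) _
  (fun z : Omega * M => (Y i z.1, z.2))); first exact: measurable_ratio.
apply: measurable_fun_pair; last exact: measurable_snd.
exact: measurableT_comp.
Qed.

Lemma measurable_lik_ratio1 n w : measurable_fun setT (lik_ratio n w).
Proof. exact: measurableT_comp (measurable_lik_ratio n) (measurable_pair1 w). Qed.

Lemma measurable_lik_ratio2 n t : measurable_fun setT (fun w => lik_ratio n w t).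
Proof. exact: measurableT_comp (measurable_lik_ratio n) (measurable_pair2 t). Qed.

Lemma finite_mixture_bound (N : nat) (B : 'I_N -> set (probability X R))
    (e rho b : R) (n m : nat) (t : nat -> M) :
  (forall i, convex_measures (B i)) ->
  (forall i, has_testing_index_ge mu P0 (p ts) (B i) e%:E) ->
  expR (- e) < rho -> (forall k, exists i, B i (P (t k))) -> 0 <= b ->
  (\int[Pr]_w (Num.min 1 (\sum_(k < m) b * lik_ratio n w (t k)))%:E <=
   (N%:R * (1 + b * m%:R) * rho ^+ n)%:E)%E.
Proof.
move=> cvxB testB erho /choice[idx Bidx] b0.
pose s i := [seq k <- iota 0 m | idx k == i].
have rho0 : 0 < rho by apply: lt_trans erho; exact: expR_gt0.
have /choice[a aP] : forall i, exists a, 0 < a <= 1 /\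
    forall v : nat -> R, (forall k, 0 <= v k) ->
    (\int[P0]_x ((\sum_(k <- s i) v k * (p (t k) x / p ts x)) `^ a)%:E <=
     (rho * (\sum_(k <- s i) v k) `^ a)%:E)%E.
  move=> i; pose c := (expR (- e) + rho) / 2.
  have ec : expR (- e) < c by rewrite /c; lra.
  have [||||||||a a01 aP] := @hull_uniform_exponent R dX X P0 (p ts)
    (densities_of mu (B i)) nat (s i) (fun k => p (t k)) c rho.
  - apply/andP; split; first by apply: lt_trans ec; exact: expR_gt0.
    by rewrite /c; lra.
  - exact: densities_of_mix_closed.
  - exact: measurable_density.
  - exact: density_ge0.
  - by move=> f [Q _ [mf f0 _]].
  - by move=> f Df; exact: testing_index_power_mean Df.
  - move=> k; rewrite mem_filter => /andP[/eqP <- _].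
    by exists (P (t k)); [exact: Bidx|exact: p_density].
  - by move=> k _; exact: ratio_finite.
  - by exists a.
have sumE w : \sum_(k < m) b * lik_ratio n w (t k) =
    \sum_(i < N) \sum_(k <- s i) b * lik_ratio n w (t k).
  rewrite -(big_mkord xpredT (fun k => b * lik_ratio n w (t k))).
  rewrite (partition_big idx xpredT)//=.
  by apply: eq_bigr => i _; rewrite big_filter /index_iota subn0.
pose S i w := \sum_(k <- s i) b * lik_ratio n w (t k).
have S0 i w : 0 <= S i w.
  by apply: sumr_ge0 => k _; rewrite mulr_ge0// lik_ratio_ge0.
have mS i : measurable_fun setT (S i).
  apply: measurable_sum => k; apply: measurable_funM => //.
  exact: measurable_lik_ratio2.
apply: (@le_trans _ _ (\int[Pr]_w \sum_(i < N) ((S i w) `^ (a i))%:E)%E).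
  apply: le_ge0_integral => w _.
    by rewrite lee_fin le_min ler01 sumE; apply: sumr_ge0 => i _; exact: S0.
  rewrite sumEFin lee_fin sumE; apply: (le_trans (minr1_sum_le _ _)).
    by move=> i; exact: S0.
  by apply: ler_sum => i _; apply: minr1_le_powR; [exact: S0|have [] := aP i].
rewrite ge0_integral_sum//; last 2 first.
- by move=> i; apply/measurable_EFinP; exact: measurable_powR_comp.
- by move=> i w _; rewrite lee_fin powR_ge0.
have -> : N%:R * (1 + b * m%:R) * rho ^+ n =
    \sum_(i < N) (1 + b * m%:R) * rho ^+ n.
  by rewrite sumr_const card_ord -[RHS]mulr_natl mulrA.
rewrite -sumEFin; apply: lee_sum => i _.
have [a01 ai] := aP i.
have r1 k : measurable_fun setT (fun x => p (t k) x / p ts x).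
  exact: measurable_ratio1.
have r0 k x : 0 <= p (t k) x / p ts x by exact: ratio_ge0.
have := @integral_mixture_power _ _ _ _ _ _ _ _ Y_iid nat (s i)
  (fun k x => p (t k) x / p ts x) (a i) rho r1 r0 (ltW rho0) ai n (fun=> b)
  (fun=> b0).
move=> /le_trans; apply; rewrite lee_fin ler_wpM2r// ?exprn_ge0//; first exact: ltW.
rewrite big_const_seq count_predT iter_addr addr0 -[_ *+ _]mulr_natr.
apply: (le_trans (powR_le1D _ _)); first by rewrite mulr_ge0.
  by case/andP: a01 => /ltW -> ->.
rewrite lerD2l ler_wpM2l// ler_nat size_filter (leq_trans (count_size _ _))//.
by rewrite size_iota.
Qed.

Variable Pi : probability M R.

Lemma set_mixture_bound (N : nat) (B : 'I_N -> set (probability X R))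
    (e rho c : R) (n : nat) (S : set M) :
  (forall i, convex_measures (B i)) ->
  (forall i, has_testing_index_ge mu P0 (p ts) (B i) e%:E) ->
  expR (- e) < rho -> 0 <= c ->
  measurable S -> (forall t, S t -> exists i, B i (P t)) ->
  (\int[Pr]_w mine 1 (c%:E * \int[Pi]_(t in S) (lik_ratio n w t)%:E) <=
   (N%:R * (1 + c * fine (Pi S)) * rho ^+ n)%:E)%E.
Proof.
move=> cvxB testB erho c0 mS SB.
have rho0 : 0 < rho by apply: lt_trans erho; exact: expR_gt0.
set pi := fine (Pi S); have pi0 : 0 <= pi by exact: fine_ge0.
set bnd := N%:R * _ * _.
have bnd0 : 0 <= bnd.
  by rewrite !mulr_ge0// ?exprn_ge0 ?addr_ge0 ?mulr_ge0// ltW.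
have PiS : Pi S = pi%:E by rewrite /pi fineK// fin_num_measure.
have mlik w : measurable_fun setT (fun t => (lik_ratio n w t)%:E).
  by apply/measurable_EFinP; exact: measurable_lik_ratio1.
have [pi_eq0|pi_neq0] := eqVneq pi 0.
  rewrite integral0_eq ?lee_fin// => w _.
  rewrite (ge0_negligible_integral mS mS).
  - by rewrite setDv integral_set0 mule0 min_r.
  - exact: measurable_funS (mlik w).
  - by move=> t _; rewrite lee_fin lik_ratio_ge0.
  - exact: (etrans PiS (congr1 EFin pi_eq0)).
have pi_gt0 : (0 < Pi S)%E by rewrite PiS lte_fin lt_neqAle eq_sym pi_neq0.
have [Q [QS QE]] := conditional_probability mS pi_gt0.
pose g (K : nat) w t := Num.min K%:R (lik_ratio n w t).
have g0K K w t : 0 <= g K w t <= K%:R.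
  by rewrite /g le_min ler0n lik_ratio_ge0/= ge_min lexx.
have mg K : measurable_fun setT (fun z : Omega * M => g K z.1 z.2).
  by apply: measurable_minr => //; exact: measurable_lik_ratio.
have mgw K w : measurable_fun setT (g K w).
  exact: (measurableT_comp (mg K) (measurable_pair1 w)).
have gQfin K w : (\int[Q]_t (g K w t)%:E)%E \is a fin_num.
  rewrite ge0_fin_numE; last first.
    by apply: integral_ge0 => t _; rewrite lee_fin; case/andP: (g0K K w t).
  apply: (@le_lt_trans _ _ (\int[Q]_t (K%:R)%:E)%E).
    by apply: le_ge0_integral => t _; rewrite lee_fin; case/andP: (g0K K w t).
  by rewrite probability_integral_cst ltry.
pose G K w := fine (\int[Q]_t (g K w t)%:E)%E.
have GE K w : (\int[Pi]_(t in S) (g K w t)%:E = (pi * G K w)%:E)%E.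
  rewrite QE; first by rewrite PiS EFinM /G (fineK (gQfin K w)).
    exact/measurable_EFinP.
  by move=> t; rewrite lee_fin; case/andP: (g0K K w t).
have G0 K w : 0 <= G K w.
  apply: fine_ge0; apply: integral_ge0 => t _.
  by rewrite lee_fin; case/andP: (g0K K w t).
have mG K : measurable_fun setT (G K).
  apply: measurableT_comp; first exact: fine_measurable.
  apply: (measurable_fun_fubini_tonelli_F
    (fun z : Omega * M => (g K z.1 z.2)%:E)); first exact/measurable_EFinP.
  by move=> z; rewrite lee_fin; case/andP: (g0K K z.1 z.2).
have trunc K : (\int[Pr]_w (Num.min 1 (c * (pi * G K w)))%:E <= bnd%:E)%E.
  apply/lee_addgt0Pr => d d0.
  pose A := c * pi * (K%:R ^+ 2 + 2).
  have A0 : 0 <= A by rewrite !mulr_ge0// addr_ge0// sqr_ge0.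
  pose m := Num.bound ((A / d) ^+ 2).
  have Am : A / Num.sqrt m.+1%:R <= d.
    rewrite ler_pdivrMr ?sqrtr_gt0// mulrC -ler_pdivrMr//.
    rewrite -(ger0_norm (divr_ge0 A0 (ltW d0))) -sqrtr_sqr ler_wsqrtr//.
    apply: ltW; apply: lt_trans (archi_boundP (sqr_ge0 _)) _.
    by rewrite ltr_nat.
  have [t [St tP]] := empirical_average_L1 Pr (mg K) (g0K K) mS QS m.
  pose b := c * pi / m.+1%:R.
  have b0 : 0 <= b by rewrite !mulr_ge0.
  have fin_bound := finite_mixture_bound n m.+1 cvxB testB erho
    (fun k => SB _ (St k)) b0.
  pose f1 w := Num.min 1 (\sum_(k < m.+1) b * lik_ratio n w (t k)).
  pose f2 w := `|\sum_(k < m.+1) (g K w (t k) - G K w)| / m.+1%:R.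
  have S0 w : 0 <= \sum_(k < m.+1) b * lik_ratio n w (t k).
    by apply: sumr_ge0 => k _; rewrite mulr_ge0// lik_ratio_ge0.
  apply: (@le_trans _ _ (\int[Pr]_w (1 * f1 w + c * pi * f2 w)%:E)%E).
    apply: le_ge0_integral => w _.
      by rewrite lee_fin le_min ler01 !mulr_ge0.
    rewrite lee_fin mul1r /f1 /f2.
    set T := \sum_(k < m.+1) b * lik_ratio n w (t k).
    set D := \sum_(k < m.+1) (g K w (t k) - G K w).
    have DE : c * (pi * G K w) <= T + c * pi * (`|D| / m.+1%:R).
      have -> : c * (pi * G K w) =
          \sum_(k < m.+1) b * g K w (t k) - b * D.
        rewrite /D -mulr_sumr sumrB sumr_const card_ord -[_ *+ _]mulr_natl.
        by rewrite mulrBr opprB addrC subrK /b [RHS]mulrA divfK ?pnatr_eq0// mulrA.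
      rewrite lerD//.
        apply: ler_sum => k _; rewrite ler_wpM2l// /g ge_min lexx orbT//.
      have -> : c * pi * (`|D| / m.+1%:R) = b * `|D| by rewrite /b; ring.
      by rewrite -mulrN ler_wpM2l// -normrN ler_norm.
    have D0 : 0 <= c * pi * (`|D| / m.+1%:R) by rewrite !mulr_ge0.
    have T0 : 0 <= T := S0 w.
    have l1 : Num.min 1 (c * (pi * G K w)) <= 1 by rewrite ge_min lexx.
    have l2 : Num.min 1 (c * (pi * G K w)) <= c * (pi * G K w).
      by rewrite ge_min lexx orbT.
    move: DE D0 l1 l2; set z := c * pi * _; set y := c * (pi * _).
    by have [T1|T1] := leP 1 T; move: (Num.min 1 y) => y1; lra.
  rewrite ge0_integral_lin2//; last 5 first.
  - rewrite /f1; apply: measurable_minr => //; apply: measurable_sum => k.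
    by apply: measurable_funM => //; exact: measurable_lik_ratio2.
  - rewrite /f2; apply: measurable_funM => //; apply: measurableT_comp => //.
    apply: measurable_sum => k; apply: measurable_funB; last exact: mG.
    exact: (measurableT_comp (mg K) (measurable_pair2 (t k))).
  - by move=> w; rewrite le_min ler01 S0.
  - by move=> w; rewrite divr_ge0.
  - by rewrite mulr_ge0.
  rewrite mul1e leeD//.
    apply: (le_trans fin_bound); rewrite lee_fin /bnd /b.
    by rewrite divfK// pnatr_eq0.
  apply: (@le_trans _ _ ((c * pi)%:E *
      ((K%:R ^+ 2 + 2) / Num.sqrt m.+1%:R)%:E)%E).
    by rewrite lee_wpmul2l// lee_fin mulr_ge0.
  by rewrite -EFinM lee_fin mulrA.
pose L w := (\int[Pi]_(t in S) (lik_ratio n w t)%:E)%E.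
have cvgL w : (c * (pi * G K w))%:E @[K --> \oo] --> (c%:E * L w)%E.
  under eq_cvg do rewrite EFinM -GE.
  apply: cvgeZl => //.
  have -> : L w = (\int[Pi]_(t in S) limn (fun K => (g K w t)%:E))%E.
    apply: eq_integral => t _; apply/esym/cvg_lim => //.
    apply: cvg_near_cst; near=> K; congr (_%:E); apply/min_idPr.
    apply: ltW; apply: lt_le_trans (archi_boundP (lik_ratio_ge0 n w t)) _.
    by rewrite ler_nat; near: K; exact: nbhs_infty_ge.
  apply: cvg_monotone_convergence => //.
  - by move=> K; apply/measurable_EFinP; exact: measurable_funS (mgw K w).
  - by move=> K t _; rewrite lee_fin; case/andP: (g0K K w t).
  - move=> t _ K1 K2 K12; rewrite lee_fin /g le_min ge_min ge_min lexx orbT andbT.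
    by rewrite ler_nat K12.
have leL K w : ((c * (pi * G K w))%:E <= c%:E * L w)%E.
  rewrite EFinM -GE lee_wpmul2l//; apply: le_ge0_integral => t _.
    by rewrite lee_fin; case/andP: (g0K K w t).
  by rewrite lee_fin /g ge_min lexx orbT.
have -> : (\int[Pr]_w mine 1 (c%:E * L w) =
    \int[Pr]_w limn_einf (fun K => (Num.min 1 (c * (pi * G K w)))%:E))%E.
  apply: eq_integral => w _; apply/esym.
  under [X in limn_einf X]eq_fun do rewrite EFin_min.
  by have [] := cvg_limn_einf_sup (cvg_mine_le (x := 1%E) (cvgL w) (leL ^~ w)).
apply: (le_trans (fatou _ _ _ _)) => //.
- move=> K; apply/measurable_EFinP; apply: measurable_minr => //.
  by do 2 apply: measurable_funM => //.
- by move=> K w _; rewrite lee_fin le_min ler01 !mulr_ge0.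
rewrite limn_einf_lim; apply: lime_le; first exact: is_cvg_einfs.
near=> K; apply: le_trans (trunc K); apply: ereal_inf_lbound.
by exists K => /=.
Unshelve. all: by end_near. Qed.

End likelihood_ratio.

(** * The denominator of the posterior *)

Lemma le_integral_pointwise d (T : measurableType d) (R : realType)
    (mu : {measure set T -> \bar R}) (D : set T) (f g : T -> \bar R) :
  (forall x, D x -> f x <= g x)%E ->
  (\int[mu]_(x in D) f x <= \int[mu]_(x in D) g x)%E.
Proof.
move=> fg; rewrite integralE [leRHS]integralE; apply: leeB.
- apply: le_ge0_integral => x Dx; first exact: funepos_ge0.
  by rewrite !funeposE ge_max !le_max fg// lexx orbT.
- apply: le_ge0_integral => x Dx; first exact: funeneg_ge0.
  by rewrite !funenegE ge_max !le_max leeN2 fg// lexx orbT.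
Qed.

Lemma measurable_lne_EFin d (T : measurableType d) (R : realType) (f : T -> R) :
  measurable_fun setT f -> measurable_fun setT (fun x => lne (f x)%:E).
Proof.
move=> mf; rewrite /lne.
apply: measurable_fun_ifT => //; first exact: measurable_fun_ler.
by apply/measurable_EFinP; apply: measurableT_comp => //; exact: measurable_ln.
Qed.

Lemma integral_lty_null d (T : measurableType d) (R : realType)
    (Q : probability T R) (f : T -> \bar R) (A : set T) :
  (forall x, 0 <= f x)%E -> (\int[Q]_x f x < +oo)%E -> measurable A ->
  (forall x, A x -> f x = +oo%E) -> Q A = 0%E.
Proof.
move=> f0 foo mA Aoo; apply/eqP; apply: contrapT => /negP QA_neq0.
have [q qE] : exists q, Q A = q%:E.
  by exists (fine (Q A)); rewrite fineK// fin_num_measure.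
have [V VE] : exists V, (\int[Q]_x f x)%E = V%:E.
  exists (fine (\int[Q]_x f x)); rewrite fineK// ge0_fin_numE//.
  exact: integral_ge0.
have V0 : 0 <= V by rewrite -lee_fin -VE; exact: integral_ge0.
have q0 : 0 < q by rewrite -lte_fin -qE lt0e QA_neq0 measure_ge0.
have c0 : 0 <= (V + 1) / q by rewrite divr_ge0 ?addr_ge0// ltW.
have := ge0_markov Q f0 mA c0.
rewrite [X in (_ * X)%E]qE VE -EFinM lee_fin divfK ?gt_eqF// => H.
suff : V + 1 <= V by lra.
by apply: H => x /Aoo ->; rewrite leey.
Qed.

Section posterior_bound.
Context {R : realType} {dX : measure_display} {X : measurableType dX}.
Context {dM : measure_display} {M : measurableType dM}.
Context {dO : measure_display} {Omega : measurableType dO}.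
Variables (mu : {measure set X -> \bar R}) (P0 : probability X R).
Variables (P : M -> probability X R) (p : M -> X -> R) (ts : M).
Hypothesis p_density : forall t, is_density mu (P t) (p t).
Hypothesis p_measurable : measurable_fun setT (fun z : X * M => p z.2 z.1).
Variables (Pr : probability Omega R) (Y : nat -> Omega -> X).
Hypothesis Y_iid : iid Pr P0 Y.
Variable Pi : probability M R.

Let mY i : measurable_fun setT (Y i). Proof. exact: measurable_obs Y_iid i. Qed.
Let mratio1 t : measurable_fun setT (fun x => p t x / p ts x).
Proof. exact (measurable_ratio1 ts p_density p_measurable t). Qed.
Let lik0 n w t : 0 <= lik_ratio p ts Y n w t.
Proof. exact: lik_ratio_ge0 ts p_density Y n w t. Qed.
Let mlik n : measurable_fun setT
  (fun z : Omega * M => lik_ratio p ts Y n z.1 z.2).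
Proof. exact (measurable_lik_ratio ts p_density p_measurable Y_iid n). Qed.

Lemma KL_finite_positive (p0 : X -> R) : measurable_fun setT p0 ->
  (forall x, 0 <= p0 x) -> (neg_log_ratio P0 (p ts) p0 < +oo)%E ->
  P0 [set x | p ts x <= 0] = 0%E.
Proof.
move=> mp0 p00 KLoo; pose h x := lne (p ts x / p0 x)%:E.
have mA : measurable [set x | p ts x <= 0].
  rewrite -[X in measurable X]setTI; under eq_set do rewrite -lee_fin.
  apply: emeasurable_fun_infty_c => //; apply/measurable_EFinP.
  exact: measurable_density p_density ts.
apply: (@integral_lty_null _ _ _ P0 h^\-%E) => //.
  rewrite ltey; apply/eqP => negoo; move: KLoo.
  rewrite /neg_log_ratio integralE -/h negoo /= addeNy.
  by rewrite /= ltxx.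
move=> x /= pts0; rewrite funenegE /h /=.
have -> : p ts x / p0 x <= 0 by rewrite mulr_le0_ge0// invr_ge0.
by rewrite /= maxye.
Qed.

Lemma measurable_KL_ball eps : measurable (KL_ball P0 p ts eps).
Proof.
pose h (z : X * M) := lne (p z.2 z.1 / p ts z.1)%:E.
have mh : measurable_fun setT h.
  by apply: measurable_lne_EFin; exact (measurable_ratio ts p_density p_measurable).
have -> : KL_ball P0 p ts eps =
    [set t | (neg_log_ratio P0 (p t) (p ts) <= (eps ^+ 2)%:E)%E] `&`
    [set t | (sq_log_ratio P0 (p t) (p ts) <= (eps ^+ 2)%:E)%E] by [].
apply: measurableI.
- rewrite -[X in measurable X]setTI; apply: emeasurable_fun_infty_c => //.
  apply: measurableT_comp => //.
  under eq_fun do rewrite integralE.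
  apply: emeasurable_funB.
  + rewrite [X in measurable_fun _ X](_ : _ =
      fun t => \int[P0]_x h^\+%E (x, t))%E; last first.
      by apply/funext => t; apply: eq_integral => x _; rewrite !funeposE.
    apply: (measurable_fun_fubini_tonelli_G h^\+%E) => //.
    exact: measurable_funepos.
  + rewrite [X in measurable_fun _ X](_ : _ =
      fun t => \int[P0]_x h^\-%E (x, t))%E; last first.
      by apply/funext => t; apply: eq_integral => x _; rewrite !funenegE.
    apply: (measurable_fun_fubini_tonelli_G h^\-%E) => //.
    exact: measurable_funeneg.
- rewrite -[X in measurable X]setTI; apply: emeasurable_fun_infty_c => //.
  apply: (measurable_fun_fubini_tonelli_G (fun z => h z ^+ 2)%E) => //.
  + exact: emeasurable_funM.
  + by move=> z; exact: sqre_ge0.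
Qed.

Lemma lik_ratio_tail t n (eps C : R) :
  KL_ball P0 p ts eps t -> 0 < eps -> 0 < C -> (0 < n)%N ->
  (Pr [set w | (lik_ratio p ts Y n w t <
                expR (- (n%:R * eps ^+ 2 * (1 + C))))%R] <=
   ((n%:R * eps ^+ 2 * C ^+ 2)^-1)%:E)%E.
Proof.
move=> [KL1 KL2] eps0 C0 n0.
pose r x := p t x / p ts x; pose f x := ln (r x).
have mf : measurable_fun setT f.
  by apply: measurableT_comp; [exact: measurable_ln|exact: mratio1].
have f1 x : (lne (r x)%:E <= (f x)%:E)%E.
  by rewrite /lne; case: ifP => // _; rewrite leNye.
have f2 x : ((f x ^+ 2)%:E <= lne (r x)%:E ^+ 2)%E.
  rewrite /lne; case: ifP => // _.
  by rewrite leey.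
have e0 : 0 < eps ^+ 2 by rewrite exprn_gt0.
have := iid_lower_tail Y_iid mf e0 C0 n0.
set A := [set w | _] => tail.
have {}tail : (Pr A <= ((n%:R * eps ^+ 2 * C ^+ 2)^-1)%:E)%E.
  apply: tail.
    by apply: le_trans KL2; apply: le_ge0_integral => x _; rewrite ?lee_fin ?sqr_ge0.
  rewrite EFinN leeNl; apply: le_trans KL1.
  by rewrite /neg_log_ratio leeN2; apply: le_integral_pointwise => x _; exact: f1.
pose N i := Y i @^-1` [set x | r x <= 0].
have mr0 : measurable [set x | r x <= 0].
  rewrite -[X in measurable X]setTI; under eq_set do rewrite -lee_fin.
  by apply: emeasurable_fun_infty_c => //; apply/measurable_EFinP; exact: mratio1.
have N0 i : Pr (N i) = 0%E.
  have [_ -> // _] := Y_iid.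
  apply: (@integral_lty_null _ _ _ P0 (fun x => lne (r x)%:E ^+ 2)%E) => //.
  - by move=> x; exact: sqre_ge0.
  - by apply: le_lt_trans KL2 _; rewrite ltry.
  - by move=> x /= rx0; rewrite rx0.
have mN i : measurable (N i).
  by rewrite /N -[X in measurable X]setTI; exact: mY.
have mUN : measurable (\bigcup_i N i) by exact: bigcupT_measurable.
have UN0 : Pr (\bigcup_i N i) = 0%E.
  apply: measure_negligible => //; apply: negligible_bigcup => i.
  by exists (N i); split; [exact: mN|exact: N0|exact: subset_refl].
have mA : measurable A.
  rewrite /A -[X in measurable X]setTI; under eq_set do rewrite -lte_fin.
  apply: emeasurable_fun_infty_o => //; apply/measurable_EFinP.
  by apply: measurable_sum => i; exact: measurableT_comp.
apply: le_trans tail; rewrite -(adde0 (Pr A)) -[X in (_ + X)%E]UN0.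
apply: (@le_trans _ _ (Pr (A `|` \bigcup_i N i))).
  apply: le_measure; rewrite ?inE.
  - rewrite -[X in measurable X]setTI; under eq_set do rewrite -lte_fin.
    apply: emeasurable_fun_infty_o => //; apply/measurable_EFinP.
    exact (measurable_lik_ratio2 ts p_density p_measurable Y_iid n t).
  - exact: measurableU.
  move=> w /= lik_lt; have [[i Ni]|Nn] := pselect (exists i, N i w).
    by right; exists i.
  left; rewrite /A /=.
  have r_gt0 i : 0 < r (Y i w).
    by rewrite ltNge; apply/negP => Ni; apply: Nn; exists i.
  rewrite -ltr_expR expR_sum; apply: le_lt_trans lik_lt.
  rewrite /lik_ratio le_eqVlt; apply/orP; left; apply/eqP.
  by apply: eq_bigr => i _; rewrite /f lnK// posrE.
rewrite measureU2//.
Qed.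

Definition deficit (K : set M) (a : R) (n : nat) (w : Omega) : \bar R :=
  (\int[Pi]_(t in K) (Num.max 0 (a - lik_ratio p ts Y n w t))%:E)%E.

Lemma integral_deficit_le n (eps C : R) :
  0 < eps -> 0 < C -> (0 < n)%N ->
  (\int[Pr]_w deficit (KL_ball P0 p ts eps)
      (expR (- (n%:R * eps ^+ 2 * (1 + C)))) n w <=
   (expR (- (n%:R * eps ^+ 2 * (1 + C))) *
      (n%:R * eps ^+ 2 * C ^+ 2)^-1)%:E * Pi (KL_ball P0 p ts eps))%E.
Proof.
move=> eps0 C0 n0; set eta := (_)^-1; set K := KL_ball _ _ _ _; set a := expR _.
have a0 : 0 < a by exact: expR_gt0.
have eta0 : 0 <= eta by rewrite invr_ge0 !mulr_ge0 ?sqr_ge0// ltW.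
have mK : measurable K by exact: measurable_KL_ball.
pose h (z : Omega * M) := (Num.max 0 (a - lik_ratio p ts Y n z.1 z.2))%:E.
have mh : measurable_fun setT h.
  apply/measurable_EFinP; apply: measurable_maxr => //.
  by apply: measurable_funB.
have h0 z : (0 <= h z)%E by rewrite lee_fin le_max lexx.
pose hK (z : Omega * M) := (h z * (\1_K z.2)%:E)%E.
have mhK : measurable_fun setT hK.
  apply: emeasurable_funM => //; apply/measurable_EFinP.
  exact: (@measurableT_comp _ _ _ _ _ _ (\1_K : M -> R) _ snd).
have hK0 z : (0 <= hK z)%E by rewrite mule_ge0// lee_fin.
have -> : (\int[Pr]_w deficit K a n w = \int[Pr]_w \int[Pi]_t hK (w, t))%E.
  apply: eq_integral => w _; rewrite /deficit integral_mkcond.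
  apply: eq_integral => t _; rewrite patchE /hK /h /= indicE.
  by case: ifPn => tK; rewrite ?mule1 ?mule0.
rewrite (fubini_tonelli hK)//.
apply: (@le_trans _ _ (\int[Pi]_t ((a * eta)%:E * (\1_K t)%:E))%E); last first.
  rewrite ge0_integralZl_EFin//.
  - by rewrite integral_indic// setIT.
  - by apply/measurable_EFinP; exact: measurable_indic.
  - by rewrite mulr_ge0// ltW.
apply: le_ge0_integral => t _; first exact: integral_ge0.
rewrite /hK /= ge0_integralZr//; last first.
  exact: (measurableT_comp mh (measurable_pair2 t)).
have [Kt|nKt] := pselect (K t); last by rewrite indicE memNset// !mule0.
rewrite lee_wpmul2r// ?lee_fin//.
pose A := [set w | lik_ratio p ts Y n w t < a].
have mA : measurable A.
  rewrite /A -[X in measurable X]setTI; under eq_set do rewrite -lte_fin.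
  apply: emeasurable_fun_infty_o => //; apply/measurable_EFinP.
  exact (measurable_lik_ratio2 ts p_density p_measurable Y_iid n t).
apply: (@le_trans _ _ (\int[Pr]_w (a%:E * (\1_A w)%:E))%E).
  apply: le_ge0_integral => w _; first exact: h0.
  rewrite /h /= -EFinM lee_fin indicE.
  have [Aw|nAw] := pselect (A w).
    by rewrite mem_set// mulr1 ge_max ltW//= gerBl.
  rewrite memNset// mulr0 ge_max lexx /= subr_le0 leNgt.
  exact/negP.
rewrite ge0_integralZl_EFin//; last 2 first.
- by apply/measurable_EFinP; exact: measurable_indic.
- exact: ltW.
rewrite integral_indic// setIT EFinM; apply: lee_wpmul2l.
  by rewrite lee_fin ltW.
exact: (lik_ratio_tail Kt eps0 C0 n0).
Qed.

End posterior_bound.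

Lemma measurable_integral_section d1 d2 (T1 : measurableType d1)
    (T2 : measurableType d2) (R : realType) (Q : probability T2 R)
    (f : T1 * T2 -> \bar R) (B : set T2) :
  measurable_fun setT f -> (forall z, 0 <= f z)%E -> measurable B ->
  measurable_fun setT (fun x => \int[Q]_(y in B) f (x, y))%E.
Proof.
move=> mf f0 mB; pose fB (z : T1 * T2) := (f z * (\1_B z.2)%:E)%E.
have -> : (fun x => \int[Q]_(y in B) f (x, y))%E =
    (fun x => \int[Q]_y fB (x, y))%E.
  apply/funext => x; rewrite integral_mkcond; apply: eq_integral => y _.
  by rewrite patchE /fB /= indicE; case: ifPn => _; rewrite ?mule1 ?mule0.
apply: (measurable_fun_fubini_tonelli_F fB).
  apply: emeasurable_funM => //; apply/measurable_EFinP.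
  exact: (@measurableT_comp _ _ _ _ _ _ (\1_B : T2 -> R) _ snd).
by move=> z; rewrite mule_ge0// lee_fin.
Qed.

(** * The posterior mass of shells *)

Lemma mine1_nneseries_le (R : realType) (x : (\bar R)^nat) :
  (forall k, 0 <= x k)%E ->
  (mine 1 (\sum_(k <oo) x k) <= \sum_(k <oo) mine 1 (x k))%E.
Proof.
move=> x0; have m0 k : (0 <= mine 1 (x k))%E by rewrite le_min lee01 x0.
have [[k x1]|nx1] := pselect (exists k, 1 <= x k)%E.
  rewrite ge_min; apply/orP; left.
  rewrite (@nneseriesD1 _ _ k)//.
  by rewrite min_l// leeDl// nneseries_ge0// => i _ _.
rewrite ge_min; apply/orP; right.
apply: lee_nneseries => [k _ _|k _]; first exact: x0.
by rewrite le_min lexx andbT leNgt; apply/negP => /ltW xk; apply: nx1; exists k.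
Qed.

Lemma posterior_ratio_le (R : realType) (x y z : \bar R) (pi c : R) :
  (0 <= x)%E -> (x <= y)%E -> (0 <= z)%E -> 0 < pi -> 0 < c ->
  (c%:E <= y)%E \/ (c%:E <= z)%E ->
  ((pi%:E * x) / (pi%:E * y) <= mine 1 (c^-1%:E * x) + c^-1%:E * z)%E.
Proof.
move=> x0 xy z0 pi0 c0 cyz.
have ci0 : 0 <= c^-1 by rewrite invr_ge0 ltW.
have r0 : (0 <= mine 1 (c^-1%:E * x) + c^-1%:E * z)%E.
  by rewrite adde_ge0// ?mule_ge0 ?lee_fin// le_min lee01 mule_ge0.
have [yoo|yoo] := eqVneq y +oo%E.
  by rewrite yoo gt0_muley// invey mule0.
have y0 := le_trans x0 xy.
move: y => [s| |] // in y0 xy cyz yoo *.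
move: x => [r| |] // in x0 xy r0 *.
rewrite -!EFinM inver mulf_eq0 (gt_eqF pi0) /=.
rewrite !lee_fin in x0 xy y0 cyz.
case: eqP => [s_eq0|/eqP s_neq0].
  have -> : pi * r = 0.
    suff -> : r = 0 by rewrite mulr0.
    by apply/eqP; rewrite eq_le x0 andbT -s_eq0.
  by rewrite mul0e; exact: r0.
have s0 : 0 < s by rewrite lt_neqAle eq_sym s_neq0.
rewrite -EFinM; have -> : pi * r * (pi * s)^-1 = r / s.
  by field; rewrite s_neq0 gt_eqF.
have rs1 : r / s <= 1 by rewrite ler_pdivrMr// mul1r.
case: cyz => [cs|cz].
  apply: (@le_trans _ _ (mine 1%E (c^-1 * r)%:E)); last first.
    by rewrite leeDl// mule_ge0.
  rewrite le_min !lee_fin rs1/= mulrC ler_wpM2r// lef_pV2 ?posrE//.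
apply: (@le_trans _ _ 1%E); first by rewrite lee_fin.
apply: (@le_trans _ _ (c^-1%:E * z)%E); last first.
  by rewrite leeDr// le_min lee01 lee_fin mulr_ge0.
apply: (@le_trans _ _ (c^-1%:E * c%:E)%E).
  by rewrite -EFinM mulVf// gt_eqF.
by rewrite lee_wpmul2l.
Qed.

Section posterior_expectation.
Context {R : realType} {dX : measure_display} {X : measurableType dX}.
Context {dM : measure_display} {M : measurableType dM}.
Context {dO : measure_display} {Omega : measurableType dO}.
Variables (mu : {measure set X -> \bar R}) (P0 : probability X R).
Variables (P : M -> probability X R) (p : M -> X -> R) (ts : M).
Hypothesis p_density : forall t, is_density mu (P t) (p t).
Hypothesis p_measurable : measurable_fun setT (fun z : X * M => p z.2 z.1).
Hypothesis ratio_finite :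
  forall t, (\int[P0]_x (p t x / p ts x)%:E < +oo)%E.
Variables (Pr : probability Omega R) (Y : nat -> Omega -> X).
Hypothesis Y_iid : iid Pr P0 Y.
Variable Pi : probability M R.
Hypothesis ts_positive : P0 [set x | p ts x <= 0] = 0%E.

Let mY i : measurable_fun setT (Y i). Proof. exact: measurable_obs Y_iid i. Qed.
Let lik0 n w t : 0 <= lik_ratio p ts Y n w t.
Proof. exact: lik_ratio_ge0 ts p_density Y n w t. Qed.
Let mlik n : measurable_fun setT
  (fun z : Omega * M => lik_ratio p ts Y n z.1 z.2).
Proof. exact (measurable_lik_ratio ts p_density p_measurable Y_iid n). Qed.
Let mlik1 n w : measurable_fun setT (fun t => (lik_ratio p ts Y n w t)%:E).
Proof.
apply/measurable_EFinP.
exact (measurable_lik_ratio1 ts p_density p_measurable Y_iid n w).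
Qed.

Definition lik_mass (n : nat) (w : Omega) (B : set M) : \bar R :=
  (\int[Pi]_(t in B) (lik_ratio p ts Y n w t)%:E)%E.

Lemma lik_mass_ge0 n w B : (0 <= lik_mass n w B)%E.
Proof. by apply: integral_ge0 => t _; rewrite lee_fin. Qed.

Lemma measurable_lik_mass n B : measurable B ->
  measurable_fun setT (lik_mass n ^~ B).
Proof.
move=> mB; apply: (@measurable_integral_section _ _ _ _ _ Pi
  (fun z : Omega * M => (lik_ratio p ts Y n z.1 z.2)%:E) B) => //.
- by apply/measurable_EFinP; exact: mlik.
- by move=> z; rewrite lee_fin.
Qed.

Lemma posterior_le n w (B K : set M) (a c : R) :
  measurable B -> measurable K -> 0 < a -> (0 < Pi K)%E ->
  (forall i, (i < n)%N -> 0 < p ts (Y i w)) -> c = a * fine (Pi K) / 2 ->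
  (posterior Pi p n (fun i => Y i w) B <=
   mine 1 (c^-1%:E * lik_mass n w B) +
   c^-1%:E * deficit p ts Y Pi K a n w)%E.
Proof.
move=> mB mK a0 K0 pts0 cE.
have Kfin : Pi K \is a fin_num by exact: fin_num_measure.
have k0 : 0 < fine (Pi K) by rewrite fine_gt0// K0/= ltey_eq Kfin.
have c0 : 0 < c by rewrite cE !mulr_gt0// invr_gt0.
pose pi := \prod_(i < n) p ts (Y i w).
have pi0 : 0 < pi by apply: prodr_gt0 => i _; exact: pts0.
have likE t : likelihood p n (fun i => Y i w) t = pi * lik_ratio p ts Y n w t.
  rewrite /likelihood /pi /lik_ratio -big_split/=; apply: eq_bigr => i _.
  by rewrite mulrC divfK// gt_eqF// pts0.
have intE D : measurable D ->
    (\int[Pi]_(t in D) (likelihood p n (fun i => Y i w) t)%:E =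
     pi%:E * lik_mass n w D)%E.
  move=> mD; under eq_integral do rewrite likE EFinM.
  rewrite ge0_integralZl_EFin//.
  - by move=> t _; rewrite lee_fin.
  - by apply: (@measurable_funS _ _ _ _ setT) => //; exact: mlik1.
  - exact: ltW.
have sub D : measurable D -> (lik_mass n w D <= lik_mass n w setT)%E.
  by move=> mD; apply: ge0_subset_integral => // t _; rewrite lee_fin.
rewrite /posterior !intE//; apply: posterior_ratio_le => //.
- exact: lik_mass_ge0.
- exact: sub.
- by apply: integral_ge0 => t _; rewrite lee_fin le_max lexx.
have cc : ((c + c)%:E <= lik_mass n w K + deficit p ts Y Pi K a n w)%E.
  rewrite /lik_mass /deficit -ge0_integralD//; last 4 first.
  - by move=> t _; rewrite lee_fin.
  - by apply: (@measurable_funS _ _ _ _ setT) => //; exact: mlik1.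
  - by move=> t _; rewrite lee_fin le_max lexx.
  - apply/measurable_EFinP; apply: measurable_maxr => //.
    apply: measurable_funB => //; apply/measurable_EFinP.
    by apply: (@measurable_funS _ _ _ _ setT) => //; exact: mlik1.
  have -> : (c + c)%:E = (\int[Pi]_(t in K) a%:E)%E.
    rewrite integral_cst// [X in (_ * X)%E](_ : _ = (fine (Pi K))%:E).
      by rewrite -EFinM cE; congr (_%:E); field.
    by rewrite fineK.
  apply: le_ge0_integral => t _; first by rewrite lee_fin ltW.
  rewrite -EFinD lee_fin -lerBlDl le_max lexx orbT//.
have [cL|Lc] := leP c%:E (lik_mass n w setT); first by left.
right; rewrite leNgt; apply/negP => Zc.
have Kc := le_lt_trans (sub _ mK) Lc.
by have := lteD Kc Zc; rewrite -EFinD ltNge cc.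
Qed.

Lemma integral_posterior_le n (B K : set M) (eps C a c : R) :
  0 < eps -> 0 < C -> (0 < n)%N -> measurable B -> (0 < Pi K)%E ->
  K = KL_ball P0 p ts eps -> a = expR (- (n%:R * eps ^+ 2 * (1 + C))) ->
  c = a * fine (Pi K) / 2 ->
  (\int[Pr]_w posterior Pi p n (fun i => Y i w) B <=
   \int[Pr]_w mine 1 (c^-1%:E * lik_mass n w B) +
   (2 * (n%:R * eps ^+ 2 * C ^+ 2)^-1)%:E)%E.
Proof.
move=> eps0 C0 n0 mB K0 KE aE cE.
have mK : measurable K.
  by rewrite KE; exact: (measurable_KL_ball P0 ts p_density p_measurable eps).
have a0 : 0 < a by rewrite aE; exact: expR_gt0.
have Kfin : Pi K \is a fin_num by exact: fin_num_measure.
have k0 : 0 < fine (Pi K) by rewrite fine_gt0// K0/= ltey_eq Kfin.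
have c0 : 0 < c by rewrite cE !mulr_gt0// invr_gt0.
have ci0 : 0 <= c^-1 by rewrite invr_ge0 ltW.
pose N i := Y i @^-1` [set x | p ts x <= 0].
have mts : measurable [set x | p ts x <= 0].
  rewrite -[X in measurable X]setTI; under eq_set do rewrite -lee_fin.
  apply: emeasurable_fun_infty_c => //; apply/measurable_EFinP.
  exact (measurable_density p_density ts).
have mN i : measurable (N i).
  by rewrite /N -[X in measurable X]setTI; exact: mY.
have N0 i : Pr (N i) = 0%E.
  by have [_ -> // _] := Y_iid; exact: ts_positive.
have mUN : measurable (\bigcup_i N i) by exact: bigcupT_measurable.
have UN0 : Pr (\bigcup_i N i) = 0%E.
  apply: measure_negligible => //; apply: negligible_bigcup => i.
  by exists (N i); split; [exact: mN|exact: N0|exact: subset_refl].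
pose Z := deficit p ts Y Pi K a n.
have Z0 w : (0 <= Z w)%E.
  by apply: integral_ge0 => t _; rewrite lee_fin le_max lexx.
have mZ : measurable_fun setT Z.
  apply: (@measurable_integral_section _ _ _ _ _ Pi (fun z : Omega * M =>
    (Num.max 0 (a - lik_ratio p ts Y n z.1 z.2))%:E) K) => //.
  - apply/measurable_EFinP; apply: measurable_maxr => //.
    by apply: measurable_funB => //; exact: mlik.
  - by move=> z; rewrite lee_fin le_max lexx.
pose F1 w := mine 1%E (c^-1%:E * lik_mass n w B)%E.
have F10 w : (0 <= F1 w)%E.
  by rewrite le_min lee01 mule_ge0// ?lik_mass_ge0// lee_fin.
have mF1 : measurable_fun setT F1.
  apply: measurable_mine => //; apply: emeasurable_funM => //.
  exact: measurable_lik_mass.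
pose G : Omega -> \bar R := (cst +oo%E) \_ (\bigcup_i N i).
have G0 w : (0 <= G w)%E by apply: erestrict_ge0 => x _; rewrite leey.
have mG : measurable_fun setT G.
  by apply: (measurable_restrictT (cst +oo%E) mUN).1; exact: measurable_cst.
apply: (@le_trans _ _ (\int[Pr]_w (F1 w + (c^-1%:E * Z w + G w)))%E).
  apply: le_ge0_integral => w _.
    rewrite /posterior mule_ge0// ?inve_ge0.
      apply: integral_ge0 => t _; rewrite lee_fin.
      by apply: prodr_ge0 => i _; exact (density_ge0 p_density t _).
    apply: integral_ge0 => t _; rewrite lee_fin.
    by apply: prodr_ge0 => i _; exact (density_ge0 p_density t _).
  have [Nw|nNw] := pselect ((\bigcup_i N i) w).
    rewrite /G patchE mem_set//= addeA.
    by rewrite addey ?leey// -ltNye (lt_le_trans (ltNyr 0))// adde_ge0// mule_ge0.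
  rewrite /G patchE memNset// adde0; apply: posterior_le => //.
  by move=> i _; rewrite ltNge; apply/negP => Ni; apply: nNw; exists i.
rewrite ge0_integralD//; last 2 first.
- by move=> w _; rewrite adde_ge0// mule_ge0.
- by apply: emeasurable_funD => //; exact: emeasurable_funM.
apply: leeD => //.
rewrite ge0_integralD//; last 2 first.
- by move=> w _; rewrite mule_ge0.
- exact: emeasurable_funM.
have -> : (\int[Pr]_w G w = 0)%E.
  by rewrite /G -integral_mkcond integral_cst// [X in (_ * X)%E]UN0 mule0.
rewrite adde0 ge0_integralZl_EFin//.
have ZB : (\int[Pr]_w Z w <=
    (a * (n%:R * eps ^+ 2 * C ^+ 2)^-1)%:E * (fine (Pi K))%:E)%E.
  rewrite fineK// /Z KE aE.
  exact (integral_deficit_le ts p_density p_measurable Y_iid Pi eps0 C0 n0).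
apply: le_trans (lee_wpmul2l _ ZB) _; first by rewrite lee_fin.
rewrite -!EFinM lee_fin cE le_eqVlt; apply/orP; left; apply/eqP.
by field; rewrite !gt_eqF// ltr0n.
Qed.

Lemma integral_lik_mass_bigcup n (c : R) (T : nat -> set M) :
  (forall k, measurable (T k)) -> 0 <= c ->
  (\int[Pr]_w mine 1 (c%:E * lik_mass n w (\bigcup_k T k)) <=
   \sum_(k <oo) \int[Pr]_w mine 1 (c%:E * lik_mass n w (seqDU T k)))%E.
Proof.
move=> mT c0.
have mD k : measurable (seqDU T k).
  by apply: measurableD => //; apply: bigsetU_measurable => i _; exact: mT.
have x0 k w : (0 <= c%:E * lik_mass n w (seqDU T k))%E.
  by rewrite mule_ge0// lik_mass_ge0.
have m0 k w : (0 <= mine 1 (c%:E * lik_mass n w (seqDU T k)))%E.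
  by rewrite le_min lee01 x0.
rewrite -integral_nneseries//; last first.
  move=> k; apply: measurable_mine => //; apply: emeasurable_funM => //.
  exact: measurable_lik_mass.
apply: le_ge0_integral => w _.
  by rewrite le_min lee01 mule_ge0// lik_mass_ge0.
apply: le_trans (mine1_nneseries_le (x0 ^~ w)).
rewrite le_min ge_min lexx /= ge_min; apply/orP; right.
rewrite nneseriesZl; last by move=> k _; exact: lik_mass_ge0.
rewrite lee_wpmul2l// /lik_mass seqDU_bigcup_eq ge0_integral_bigcup//.
  by apply: (@measurable_funS _ _ _ _ setT) => //; exact: mlik1.
by move=> t _; rewrite lee_fin.
Qed.

Lemma integral_lik_mass_shell (d : M -> M -> R) (eps C a c : R) (n j : nat)
    (K S : set M) :
  0 < eps -> 0 < C -> (1 < j)%N -> measurable K -> measurable S ->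
  S `<=` shell d ts (j%:R * eps) (2 * j%:R * eps) ->
  measurable (shell d ts (j%:R * eps) (2 * j%:R * eps)) ->
  (0 < Pi K)%E -> a = expR (- (n%:R * eps ^+ 2 * (1 + C))) ->
  c = a * fine (Pi K) / 2 ->
  (Pi (shell d ts (j%:R * eps) (2 * j%:R * eps)) / Pi K <=
   (expR (n%:R * eps ^+ 2 * j%:R ^+ 2 / 8))%:E)%E ->
  (covering_number_testing mu P0 P p d ts (j%:R * eps) <=
   (expR (n%:R * eps ^+ 2))%:E)%E ->
  (\int[Pr]_w mine 1 (c^-1%:E * lik_mass n w S) <=
   (6 * expR (n%:R * eps ^+ 2 * (2 + C) - n%:R * eps ^+ 2 * j%:R ^+ 2 / 16))%:E)%E.
Proof.
move=> eps0 C0 j1 mK mS Ssub mshell K0 aE cE prior entropy.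
set x := n%:R * eps ^+ 2 in aE prior entropy *.
set e := j%:R * eps in Ssub mshell prior entropy *.
have x0 : 0 <= x by rewrite mulr_ge0// sqr_ge0.
have j0 : 0 < j%:R :> R by rewrite ltr0n; exact: ltnW.
have e0 : 0 < e by rewrite mulr_gt0.
have Kfin : Pi K \is a fin_num by exact: fin_num_measure.
have k0 : 0 < fine (Pi K) by rewrite fine_gt0// K0/= ltey_eq Kfin.
have a0 : 0 < a by rewrite aE; exact: expR_gt0.
have c0 : 0 < c by rewrite cE !mulr_gt0// invr_gt0.
have ci0 : 0 <= c^-1 by rewrite invr_ge0 ltW.
have : (covering_number_testing mu P0 P p d ts e < (expR x + 1)%:E)%E.
  by apply: le_lt_trans entropy _; rewrite lte_fin ltrDl.
move=> /ereal_inf_lt[_ [N [B [cvxB densB coverB testB]] <-]].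
rewrite lte_fin => ltN.
pose rho := expR (- (3 / 16 * e ^+ 2)).
have e2 : 0 < e ^+ 2 by rewrite exprn_gt0.
have erho : expR (- (e ^+ 2 / 4)) < rho by rewrite ltr_expR; lra.
have SB t : S t -> exists i, B i (P t).
  by move=> /Ssub; rewrite -mulrA -/e; exact: coverB.
have := set_mixture_bound p_density p_measurable ratio_finite Y_iid Pi n
  cvxB testB erho ci0 mS SB.
move=> /le_trans; apply; rewrite lee_fin.
have PiS : fine (Pi S) <= fine (Pi K) * expR (x * j%:R ^+ 2 / 8).
  have Sfin : Pi S \is a fin_num by exact: fin_num_measure.
  rewrite -lee_fin EFinM !fineK//.
  apply: (@le_trans _ _ (Pi (shell d ts e (2 * j%:R * eps)))).
    by apply: le_measure => //; rewrite inE.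
  move: prior; rewrite -{1}(fineK Kfin) inver gt_eqF// => prior.
  move: prior; rewrite lee_pdivrMr//.
  by rewrite muleC fineK.
have rhon : rho ^+ n = expR (- (3 / 16 * (x * j%:R ^+ 2))).
  by rewrite /rho -expRM_natl /x /e; congr expR; ring.
have cS : c^-1 * fine (Pi S) <= 2 * expR (x * (1 + C) + x * j%:R ^+ 2 / 8).
  rewrite ler_pdivrMl// cE aE.
  have -> : expR (- (x * (1 + C))) * fine (Pi K) / 2 *
      (2 * expR (x * (1 + C) + x * j%:R ^+ 2 / 8)) =
      fine (Pi K) * expR (x * j%:R ^+ 2 / 8) *
      (expR (x * (1 + C)) * expR (- (x * (1 + C)))).
    by rewrite expRD; field.
  by rewrite expRxMexpNx_1 mulr1.
set y := x * j%:R ^+ 2 in PiS rhon cS *.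
have y0 : 0 <= y by rewrite mulr_ge0// sqr_ge0.
have eu1 : 1 <= expR (x * (1 + C) + y / 8).
  have xC : 0 <= x * (1 + C) by rewrite mulr_ge0// addr_ge0// ltW.
  by rewrite -[leLHS]expR0 ler_expR; lra.
have ex1 : 1 <= expR x by rewrite -[leLHS]expR0 ler_expR.
rewrite rhon.
apply: (@le_trans _ _ ((2 * expR x) * (3 * expR (x * (1 + C) + y / 8)) *
    expR (- (3 / 16 * y)))).
  rewrite ler_wpM2r ?expR_ge0// ler_pM//.
  - by rewrite addr_ge0// mulr_ge0// fine_ge0.
  - by lra.
  - by lra.
rewrite le_eqVlt; apply/orP; left; apply/eqP.
have -> : x * (2 + C) - y / 16 =
    x + (x * (1 + C) + y / 8) + - (3 / 16 * y) by field.
by rewrite !expRD; ring.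
Qed.

End posterior_expectation.

Lemma cvge_0_squeeze (R : realType) (u : (\bar R)^nat) :
  (forall n, 0 <= u n)%E ->
  (forall e : R, 0 < e -> \forall n \near \oo, (u n <= e%:E)%E) ->
  u n @[n --> \oo] --> 0%E.
Proof.
move=> u0 u_le; apply/fine_cvgP; split.
  have u1 := u_le 1 ltr01; apply: filterS u1 => n un.
  by rewrite ge0_fin_numE// (le_lt_trans un)// ltry.
apply/cvgrPdist_le => e e0; have ue := u_le e e0; apply: filterS ue => n /= un.
have ufin : u n \is a fin_num by rewrite ge0_fin_numE// (le_lt_trans un)// ltry.
rewrite sub0r normrN ger0_norm ?fine_ge0//.
by rewrite -lee_fin fineK.
Qed.

Lemma limn_einf_gt0_near (R : realType) (u : R^nat) :
  (0 < limn_einf (fun n => (u n)%:E))%E ->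
  exists2 c : R, 0 < c & \forall n \near \oo, c <= u n.
Proof.
rewrite limn_einf_lim => lim0.
have [N N0] : exists N, (0 < einfs (fun n => (u n)%:E) N)%E.
  apply: contrapT => nex; move: lim0; rewrite ltNge => /negP; apply.
  apply: lime_le; first exact: is_cvg_einfs.
  by near=> n; rewrite leNgt; apply/negP => n0; apply: nex; exists n.
have uN n : (N <= n)%N -> (einfs (fun n => (u n)%:E) N <= (u n)%:E)%E.
  by move=> Nn; apply: ereal_inf_lbound; exists n.
move: (einfs _ N) N0 uN => [c| |] // c0 uN; last first.
  by have := uN N (leqnn N); rewrite leye_eq.
exists c => //; near=> n; rewrite -lee_fin; apply: uN.
by near: n; exact: nbhs_infty_ge.
Unshelve. all: by end_near. Qed.

Lemma shells_cover (R : realType) dM (M : measurableType dM)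
    (d : M -> M -> R) (ts : M) (eps m : R) (J : nat) :
  0 < eps -> (1 < J)%N -> J%:R + 1 <= m ->
  [set t | m * eps <= d t ts] `<=`
  \bigcup_k shell d ts ((J + k)%:R * eps) (2 * (J + k)%:R * eps).
Proof.
move=> eps0 J1 Jm t /= mt.
pose q := d t ts / eps.
have qE : d t ts = q * eps by rewrite /q divfK// gt_eqF.
have mq : J%:R + 1 <= q by apply: le_trans Jm _; rewrite ler_pdivlMr.
have q0 : 0 <= q by apply: le_trans mq; rewrite addr_ge0.
have /andP[] := truncn_itv q0; set h := Num.truncn q => hq qh.
have Jh : (J.+1 <= h)%N.
  by rewrite -ltnS -(ltr_nat R) (le_lt_trans _ qh)// -natr1.
have hE : (J + (h - J.+1))%N = h.-1 by lia.
exists (h - J.+1)%N => //; rewrite /shell /= hE qE.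
rewrite !ltr_pM2r//.
have h1 : h = h.-1.+1 by lia.
have h2 : (2 <= h.-1)%N by lia.
have : 2 <= h.-1%:R :> R by rewrite ler_nat.
move: hq qh; rewrite {1 2}h1 -natr1 -natr1 -natr1.
lra.
Qed.

Lemma expR_shell_sum (R : realType) (x C c0 : R) (J k : nat) :
  0 < c0 -> c0 <= x -> 32 * (2 + C) <= J%:R -> 32 / c0 <= J%:R -> (0 < J)%N ->
  6 * expR (x * (2 + C) - x * (J + k)%:R ^+ 2 / 16) <=
  12 * expR (- J%:R) / (2 ^ k.+1)%:R.
Proof.
move=> c00 cx JC Jc J0; set j : R := (J + k)%:R.
have J1 : 1 <= J%:R :> R by rewrite ler1n.
have Jj : J%:R <= j by rewrite ler_nat leq_addr.
have j1 : 1 <= j by exact: le_trans Jj.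
have x0 : 0 < x by exact: lt_le_trans cx.
have cJ : 32 <= c0 * J%:R by move: Jc; rewrite ler_pdivrMr// mulrC.
have xJ : 32 <= x * J%:R by apply: le_trans cJ _; rewrite ler_wpM2r.
have xj : 32 * j <= x * j ^+ 2.
  rewrite expr2 mulrA ler_wpM2r ?ler0n//.
  by apply: le_trans xJ _; rewrite ler_pM2l.
have jj : 32 * (2 + C) <= j ^+ 2.
  by apply: le_trans JC _; apply: le_trans Jj _; rewrite expr2 ler_peMl ?ler0n.
have xC : 32 * (x * (2 + C)) <= x * j ^+ 2.
  by rewrite mulrCA ler_pM2l.
have -> : 12 * expR (- J%:R) / (2 ^ k.+1)%:R =
    6 * (expR (- J%:R) * 2^-1 ^+ k) :> R.
  by rewrite natrX exprS exprVn; field; rewrite expf_neq0.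
rewrite ler_pM2l//.
apply: (@le_trans _ _ (expR (- j))); first by rewrite ler_expR; lra.
rewrite /j natrD opprD expRD ler_pM2l ?expR_gt0//.
rewrite -mulrN1 expRM_natl lerXn2r ?nnegrE ?expR_ge0 ?invr_ge0//.
rewrite expRN lef_pV2 ?posrE ?expR_gt0//.
by have := expR_ge1Dx (1 : R); lra.
Qed.

Theorem theorem2p2 (R : realType)
  (* sample space, dominating measure, true distribution and its density *)
  (dX : measure_display) (X : measurableType dX)
  (mu : {sigma_finite_measure set X -> \bar R})
  (P0 : probability X R) (p0 : X -> R)
  (p0_density : is_density mu P0 p0)
  (* the model: a collection of distributions with a sigma-field *)
  (dM : measure_display) (M : measurableType dM)
  (P : M -> probability X R)
  (P_inj : forall s t, (forall A, measurable A -> P s A = P t A) -> s = t)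
  (p : M -> X -> R)
  (p_density : forall t, is_density mu (P t) (p t))
  (p_measurable : measurable_fun setT (fun z : X * M => p z.2 z.1))
  (d : M -> M -> R) (d_semimetric : semimetric d)
  (Pi : probability M R)
  (* the point P* = P ts of the model *)
  (ts : M)
  (d_measurable : measurable_fun setT (fun t => d t ts))
  (KL_finite : (neg_log_ratio P0 (p ts) p0 < +oo)%E)
  (ratio_finite : forall t, (\int[P0]_x (p t x / p ts x)%:E < +oo)%E)
  (* the rate *)
  (eps : nat -> R)
  (eps_gt0 : forall n, (0 < n)%N -> 0 < eps n)
  (eps_cvg0 : eps n @[n --> \oo] --> 0)
  (eps_liminf : (0 < limn_einf (fun n => (n%:R * eps n ^+ 2)%:E))%E)
  (prior_mass : forall n j : nat, (0 < n)%N -> (0 < j)%N ->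
     (Pi (shell d ts (j%:R * eps n) (2 * j%:R * eps n))
        / Pi (KL_ball P0 p ts (eps n))
      <= (expR (n%:R * eps n ^+ 2 * j%:R ^+ 2 / 8))%:E)%E)
  (entropy : forall n : nat, (0 < n)%N -> forall e : R, eps n < e ->
     (covering_number_testing mu P0 P p d ts e
      <= (expR (n%:R * eps n ^+ 2))%:E)%E)
  (* the i.i.d. observations *)
  (dO : measure_display) (Omega : measurableType dO)
  (Pr : probability Omega R)
  (Y : nat -> Omega -> X) (Y_iid : iid Pr P0 Y)
  (Mn : nat -> R) (Mn_cvg : Mn n @[n --> \oo] --> +oo) :
  (\int[Pr]_w posterior Pi p n (fun i => Y i w)
                [set t | (Mn n * eps n <= d t ts)%R])%E
    @[n --> \oo] --> 0%E.
Proof.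
have [mp0 p00 _] := p0_density.
have ts_pos := KL_finite_positive p_density mp0 p00 KL_finite.
have [c0 c00 near_c0] := limn_einf_gt0_near eps_liminf.
have post0 n w B : (0 <= posterior Pi p n (fun i => Y i w) B)%E.
  rewrite /posterior mule_ge0// ?inve_ge0.
    apply: integral_ge0 => t _; rewrite lee_fin.
    by apply: prodr_ge0 => i _; exact (density_ge0 p_density t _).
  apply: integral_ge0 => t _; rewrite lee_fin.
  by apply: prodr_ge0 => i _; exact (density_ge0 p_density t _).
apply: cvge_0_squeeze => [n|e e0].
  by apply: integral_ge0 => w _; exact: post0.
pose C := 1 + 4 / (c0 * e).
have ce0 : 0 < 4 / (c0 * e) by rewrite divr_gt0// mulr_gt0.
have C0 : 0 < C by rewrite addr_gt0.
pose b := 32 * (2 + C) + 32 / c0 + 24 / e.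
have b1 : 0 <= 32 * (2 + C) by rewrite mulr_ge0// addr_ge0// ltW.
have b2 : 0 <= 32 / c0 by rewrite divr_ge0// ltW.
have b3 : 0 <= 24 / e by rewrite divr_ge0// ltW.
have b0 : 0 <= b by rewrite !addr_ge0.
pose J := (Num.bound b).+2.
have bJ : b <= J%:R.
  apply: ltW; apply: lt_trans (archi_boundP b0) _.
  by rewrite ltr_nat.
have mshell a a' : measurable (shell d ts a a').
  rewrite -[X in measurable X]setTI.
  have -> : shell d ts a a' = (fun t => d t ts) @^-1` `]a, a'[%classic.
    by apply/seteqP; split=> t /=; rewrite in_itv.
  exact: d_measurable.
have mB a : measurable [set t | a <= d t ts].
  rewrite -[X in measurable X]setTI.
  have -> : [set t | a <= d t ts] = (fun t => d t ts) @^-1` `[a, +oo[%classic.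
    by apply/seteqP; split=> t /=; rewrite in_itv/= andbT.
  exact: d_measurable.
have near_MJ : \forall n \near \oo, J%:R + 1 <= Mn n.
  by move/cvgryPge : Mn_cvg; exact.
near=> n.
have n0 : (0 < n)%N by near: n; exact: nbhs_infty_gt.
have cx : c0 <= n%:R * eps n ^+ 2 by near: n.
have MJ : J%:R + 1 <= Mn n by near: n.
have epsn := eps_gt0 n n0.
set B := [set t | _].
pose K := KL_ball P0 p ts (eps n).
have mK : measurable K :=
  measurable_KL_ball P0 ts p_density p_measurable (eps n).
pose T k := shell d ts ((J + k)%:R * eps n) (2 * (J + k)%:R * eps n).
have mT k : measurable (T k) by exact: mshell.
have mUT : measurable (\bigcup_k T k) by exact: bigcupT_measurable.
have BT : B `<=` \bigcup_k T k by exact: shells_cover.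
have jk k : (0 < J + k)%N by rewrite addn_gt0.
have [K0|K0] := leP (Pi K) 0%E.
  have {}K0 : Pi K = 0%E by apply/eqP; rewrite eq_le K0 measure_ge0.
  have T0 k : Pi (T k) = 0%E.
    apply/eqP; rewrite eq_le measure_ge0 andbT leNgt; apply/negP => Tk.
    by have := prior_mass n _ n0 (jk k); rewrite K0 inve0 gt0_muley.
  have B0 : Pi B = 0%E.
    apply: measure_negligible; first exact: mB.
    apply: (negligibleS BT).
    apply: negligible_bigcup => k.
    by exists (T k); split; [exact: mT|exact: T0|exact: subset_refl].
  rewrite integral0_eq ?lee_fin ?ltW// => w _.
  rewrite /posterior (ge0_negligible_integral (mB _) (mB _) _ _ B0).
  - by rewrite setDv integral_set0 mul0e.
  - apply/measurable_EFinP; apply: (@measurable_funS _ _ _ _ setT) => //.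
    apply: measurable_prod => i _.
    exact (measurableT_comp p_measurable (measurable_pair1 (Y i w))).
  - move=> t _; rewrite lee_fin.
    by apply: prodr_ge0 => i _; exact (density_ge0 p_density t _).
have post_le := integral_posterior_le p_density p_measurable Y_iid
  ts_pos epsn C0 n0 (mB (Mn n * eps n)) K0 erefl erefl erefl.
apply: (le_trans post_le).
set a := expR _; set c := a * _ / 2.
have a0 : 0 < a by exact: expR_gt0.
have Kfin : Pi K \is a fin_num by exact: fin_num_measure.
have k0 : 0 < fine (Pi K) by rewrite fine_gt0// K0/= ltey_eq Kfin.
have ci0 : 0 <= c^-1 by rewrite invr_ge0 !mulr_ge0// ?invr_ge0// ltW.
have tail : (2 * (n%:R * eps n ^+ 2 * C ^+ 2)^-1)%R <= e / 2.
  have C1 : 1 <= C by rewrite lerDl ltW.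
  have CC : 4 / (c0 * e) <= C ^+ 2.
    apply: (@le_trans _ _ C); first by rewrite lerDr.
    by rewrite expr2 ler_peMl// ltW.
  have xC0 : 0 < n%:R * eps n ^+ 2 * C ^+ 2.
    by rewrite !mulr_gt0 ?exprn_gt0// ltr0n.
  rewrite ler_pdivrMr// mulrAC ler_pdivlMr//.
  rewrite ler_pdivrMr ?mulr_gt0// in CC.
  have : C ^+ 2 * (c0 * e) <= e * (n%:R * eps n ^+ 2 * C ^+ 2).
    have -> : e * (n%:R * eps n ^+ 2 * C ^+ 2) =
        C ^+ 2 * (n%:R * eps n ^+ 2 * e) by ring.
    by rewrite ler_wpM2l ?sqr_ge0// ler_pM2r.
  lra.
have head : (\int[Pr]_w mine 1 (c^-1%:E * lik_mass p ts Y Pi n w B) <=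
    (12 * expR (- J%:R))%:E)%E.
  apply: (@le_trans _ _
      (\int[Pr]_w mine 1 (c^-1%:E * lik_mass p ts Y Pi n w (\bigcup_k T k)))%E).
    apply: le_ge0_integral => w _.
      by rewrite le_min lee01 mule_ge0//; exact (lik_mass_ge0 ts p_density Y Pi n w B).
    rewrite le_min ge_min lexx /= ge_min; apply/orP; right.
    rewrite lee_wpmul2l//; apply: ge0_subset_integral => //.
    - exact: mB.
    - apply: (@measurable_funS _ _ _ _ setT) => //.
      apply/measurable_EFinP.
      exact (measurable_lik_ratio1 ts p_density p_measurable Y_iid n w).
    - by move=> t _; rewrite lee_fin; exact (lik_ratio_ge0 ts p_density Y n w t).
  apply: (le_trans (integral_lik_mass_bigcup ts p_density p_measurable Y_iid Pi n mT ci0)).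
  apply: (le_trans _ (epsilon_trick0 xpredT _)); last first.
    by rewrite mulr_ge0// expR_ge0.
  apply: lee_nneseries => [k _ _|k _].
    apply: integral_ge0 => w _.
    by rewrite le_min lee01 mule_ge0//; exact (lik_mass_ge0 ts p_density Y Pi n w _).
  have eps_lt : eps n < (J + k)%:R * eps n.
    by rewrite -[ltLHS]mul1r ltr_pM2r// ltr1n.
  apply: (le_trans (integral_lik_mass_shell p_density p_measurable ratio_finite
    Y_iid (j := (J + k)%N) epsn C0 _ mK _ (@subset_seqDU _ T k) (mT k) K0 erefl
    erefl (prior_mass n _ n0 (jk k)) (entropy n n0 _ eps_lt))) => //.
    by apply: measurableD => //; apply: bigsetU_measurable => i _; exact: mT.
  rewrite lee_fin; apply: (expR_shell_sum _ c00) => //.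
  - by move: bJ; rewrite /b; lra.
  - by move: bJ; rewrite /b; lra.
apply: (@le_trans _ _ ((12 * expR (- J%:R))%:E + (e / 2)%:E)%E).
  by rewrite leeD.
rewrite -EFinD lee_fin.
have eJ : expR (- J%:R) <= e / 24.
  have J0 : 0 < J%:R :> R by rewrite ltr0n.
  have le1 := expR_ge1Dx (J%:R : R).
  rewrite expRN -[leRHS]invf_div lef_pV2 ?posrE ?expR_gt0 ?divr_gt0//.
  by apply: le_trans le1; move: bJ; rewrite /b; lra.
lra.
Unshelve. all: by end_near. Qed.
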